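(* Fix an o-minimal structure on $(\mathbb{R},+,\cdot)$ and a positive integer $p$. Let $\Omega\subset\mathbb{R}^m$ and let $f\colon\Omega\to\mathbb{R}^n$ be a definable function (not necessarily continuous). Define $f^{-1}(0)^g:=\{x\in\mathbb{R}^m\mid (x,0)\in\overline{\Gamma_f}\}$. Then for any $a\in f^{-1}(0)^g$ there exist a neighbourhood $U$ of $a$ and an odd, strictly increasing, definable bijection $\phi\colon\mathbb{R}\to\mathbb{R}$ of class $\mathscr{C}^p$ which is $p$-flat at zero, such that $$\|f(x)\|\geq\phi\big(d(x,f^{-1}(0)^g)\big),\qquad x\in U\cap\Omega.$$
   Context: An o-minimal structure is a collection $\mathcal{S}=\{\mathcal{S}_n\}$, $\mathcal{S}_n$ a Boolean algebra of subsets of $\mathbb{R}^n$ containing all algebraic sets, closed under products and linear projections $\mathbb{R}^{n+1}\to\mathbb{R}^n$, with $\mathcal{S}_1$ consisting exactly of finite unions of points and intervals; elements are called definable, and a function is definable if its graph is. $\phi$ is $p$-flat at zero if $\phi^{(k)}(0)=0$ for $k=0,\dots,p$. $\Gamma_f$ is the graph of $f$, $\overline{\Gamma_f}$ its closure. *)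

(* Defs.v *)
From Stdlib Require Import Reals Lra List ClassicalEpsilon.
Import ListNotations.
Open Scope R_scope.

(* Points of R^n are lists of reals of length n; subsets of R^n are
   predicates on lists (required to contain only lists of length n). *)

Inductive rpoly : Type :=
| PVar : nat -> rpoly
| PConst : R -> rpoly
| PAdd : rpoly -> rpoly -> rpoly
| PMul : rpoly -> rpoly -> rpoly.

Fixpoint peval (P : rpoly) (x : list R) : R :=
  match P with
  | PVar i => nth i x 0
  | PConst c => c
  | PAdd P Q => peval P x + peval Q x
  | PMul P Q => peval P x * peval Q x
  end.

Definition algebraic_set (n : nat) (Ps : list rpoly) : list R -> Prop :=
  fun x => length x = n /\ Forall (fun P => peval P x = 0) Ps.

(* Cells of R: points and open intervals with endpoints in R ∪ {±∞}
   (None on the left = -∞, None on the right = +∞). *)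
Inductive cell : Type :=
| CPoint : R -> cell
| CInterval : option R -> option R -> cell.

Definition in_cell (c : cell) (t : R) : Prop :=
  match c with
  | CPoint a => t = a
  | CInterval lo hi =>
      (match lo with Some a => a < t | None => True end) /\
      (match hi with Some b => t < b | None => True end)
  end.

Record OMinimalStructure : Type := {
  Def : nat -> (list R -> Prop) -> Prop;
  Def_dim : forall n A, Def n A -> forall x, A x -> length x = n;
  Def_ext : forall n A B, Def n A -> (forall x, A x <-> B x) -> Def n B;
  Def_empty : forall n, Def n (fun _ => False);
  Def_compl : forall n A, Def n A -> Def n (fun x => length x = n /\ ~ A x);
  Def_union : forall n A B, Def n A -> Def n B -> Def n (fun x => A x \/ B x);
  Def_inter : forall n A B, Def n A -> Def n B -> Def n (fun x => A x /\ B x);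
  Def_algebraic : forall n Ps, Def n (algebraic_set n Ps);
  Def_prod : forall n m A B, Def n A -> Def m B ->
      Def (n + m) (fun z => exists x y, z = x ++ y /\ A x /\ B y);
  Def_proj : forall n A, Def (S n) A ->
      Def n (fun x => exists t, A (x ++ [t]));
  Def_one : forall A, Def 1 A <->
      exists cs : list cell, forall x,
        A x <-> exists t, x = [t] /\ Exists (fun c => in_cell c t) cs
}.

Definition enorm (x : list R) : R :=
  sqrt (fold_right (fun a s => a * a + s) 0 x).

Definition edist (x y : list R) : R :=
  enorm (map (fun p => fst p - snd p) (combine x y)).

Definition is_glb (E : R -> Prop) (l : R) : Prop :=
  (forall y, E y -> l <= y) /\ (forall l', (forall y, E y -> l' <= y) -> l' <= l).

(* d(x, Z) = inf { |x - z| : z in Z } (meaningful when Z is nonempty). *)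
Definition setdist (Z : list R -> Prop) (x : list R) : R :=
  epsilon (inhabits 0) (fun d => is_glb (fun r => exists z, Z z /\ r = edist x z) d).

Definition graph (Omega : list R -> Prop) (f : list R -> list R) : list R -> Prop :=
  fun z => exists x, Omega x /\ z = x ++ f x.

Definition closure (k : nat) (A : list R -> Prop) : list R -> Prop :=
  fun z => length z = k /\
    forall eps, 0 < eps -> exists w, A w /\ edist z w < eps.

Definition gen_zero_set (m n : nat) (Omega : list R -> Prop) (f : list R -> list R)
  : list R -> Prop :=
  fun x => length x = m /\ closure (m + n) (graph Omega f) (x ++ repeat 0 n).

Definition Ck_derivs (p : nat) (phi : R -> R) (D : nat -> R -> R) : Prop :=
  D 0%nat = phi /\
  (forall k, (k < p)%nat -> forall x, derivable_pt_lim (D k) x (D (S k) x)) /\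
  continuity (D p).

Definition of_class_C (p : nat) (phi : R -> R) : Prop :=
  exists D, Ck_derivs p phi D.

Definition p_flat_at_zero (p : nat) (phi : R -> R) : Prop :=
  exists D, Ck_derivs p phi D /\ forall k, (k <= p)%nat -> D k 0 = 0.

Definition definable_fun1 (S : OMinimalStructure) (phi : R -> R) : Prop :=
  Def S 2 (fun z => exists t, z = [t; phi t]).

(* Main.v *)
Require Import Defs.
From Stdlib Require Import Reals Lra Lia List ClassicalEpsilon FunctionalExtensionality.
Import ListNotations.
Open Scope R_scope.

(** Let [Z] be the generalized zero set and let [mu t] be the infimum of [1] and of
    the values [|f x|] with [|x - a| <= 1] and [d(x, Z) >= t].  The function [mu] is
    definable and nondecreasing, and compactness makes it positive for [t > 0], so
    it suffices to find a smooth flat function below [mu].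

    By o-minimality a definable condition either holds or fails on a whole
    interval to the right of any point.  Hence a definable function [g] has
    one-sided limits and one-sided derivatives in [[-oo, +oo]] everywhere; a nested
    interval argument gives continuity, and a mean value argument
    differentiability, near [0+].  If [g] is bounded then so is [t g'(t)], since
    [g' > K / t] would force [g] to vary too much between [t / 2] and [t].
    Therefore [(t^k h)' = t^(k-1) (k h + t h')] has the same shape as [t^k h], and
    [psi t = t^(2p+3) mu |t|] is [C^p] and [p]-flat at [0], odd and increasing.
    Finally [phi t = psi (d t / sqrt (1 + t^2)) (1 + t^2)], with [d] small, turns
    this germ into a bijection of the line. *)

(** * Definability of first-order conditions *)

(** The length guard lets [P] be any predicate on lists; equivalences need checking on lists of
    length [n] only. *)
Definition definable (M : OMinimalStructure) (n : nat) (P : list R -> Prop) : Prop :=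
  Def M n (fun x => length x = n /\ P x).

Lemma definable_ext M n (P Q : list R -> Prop) :
  definable M n P -> (forall x, length x = n -> (P x <-> Q x)) -> definable M n Q.
Proof.
  intros HP H. eapply Def_ext; [exact HP|].
  intros x; split; intros [Hx Hp]; split; trivial; apply (H x Hx); trivial.
Qed.

Lemma definable_not M n P : definable M n P -> definable M n (fun x => ~ P x).
Proof.
  intros HP. eapply Def_ext; [apply Def_compl; exact HP|]. cbn. tauto.
Qed.

Lemma definable_and M n P Q :
  definable M n P -> definable M n Q -> definable M n (fun x => P x /\ Q x).
Proof.
  intros HP HQ. eapply Def_ext; [apply (Def_inter _ _ _ _ HP HQ)|]. cbn. tauto.
Qed.

Lemma definable_or M n P Q :
  definable M n P -> definable M n Q -> definable M n (fun x => P x \/ Q x).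
Proof.
  intros HP HQ. eapply Def_ext; [apply (Def_union _ _ _ _ HP HQ)|]. cbn. tauto.
Qed.

Lemma definable_exists M n (P : list R -> Prop) :
  definable M (S n) P -> definable M n (fun x => exists t, P (x ++ [t])).
Proof.
  intros HP. eapply Def_ext; [apply Def_proj; exact HP|].
  intros x; cbn; setoid_rewrite length_app; cbn; split.
  - intros [t [Hl Ht]]. split; [lia|eauto].
  - intros [Hl [t Ht]]. exists t. split; [lia|trivial].
Qed.

Lemma definable_exists_block M k : forall n (P : list R -> Prop),
  definable M (n + k) P ->
  definable M n (fun x => exists y, length y = k /\ P (x ++ y)).
Proof.
  induction k as [|k IH]; intros n P HP.
  - rewrite Nat.add_0_r in HP. eapply definable_ext; [exact HP|].
    intros x _; split.
    + intros H; exists []; rewrite app_nil_r; auto.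
    + intros [[|t y] [Hy H]]; [now rewrite app_nil_r in H|discriminate].
  - eapply definable_ext.
    { apply definable_exists, IH. rewrite <- Nat.add_succ_comm in HP. exact HP. }
    intros x _; cbn; split.
    + intros [t [y [Hy H]]]. exists (t :: y). cbn. rewrite <- app_assoc in H. auto.
    + intros [[|t y] [Hy H]]; [discriminate|].
      exists t, y. rewrite <- app_assoc. cbn in *. auto.
Qed.

(** * Coordinate maps and definable real-valued functions *)

Definition select (l : list nat) (x : list R) : list R := map (fun i => nth i x 0) l.

Lemma select_block (u v w : list R) i k :
  length u = i -> length v = k -> select (seq i k) (u ++ v ++ w) = v.
Proof.
  intros <- <-. unfold select.
  apply nth_ext with (d := 0) (d' := 0); [now rewrite length_map, length_seq|].
  rewrite length_map, length_seq. intros j Hj.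
  rewrite nth_indep with (d' := nth 0%nat (u ++ v ++ w) 0)
    by (now rewrite length_map, length_seq).
  rewrite (map_nth (fun i => nth i (u ++ v ++ w) 0)), seq_nth by exact Hj.
  rewrite app_nth2 by lia. rewrite app_nth1 by lia. f_equal. lia.
Qed.

Lemma select_block_end (u v : list R) i k :
  length u = i -> length v = k -> select (seq i k) (u ++ v) = v.
Proof.
  intros Hu Hv. rewrite <- (app_nil_r v) at 1. now apply select_block.
Qed.

Lemma select_block_start (v w : list R) k :
  length v = k -> select (seq 0 k) (v ++ w) = v.
Proof. apply (select_block []). reflexivity. Qed.

Lemma select_firstn (x : list R) n :
  (n <= length x)%nat -> select (seq 0 n) x = firstn n x.
Proof.
  intros H. rewrite <- (firstn_skipn n x) at 1.
  apply select_block_start. now apply firstn_length_le.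
Qed.

Lemma firstn_app_exact (x y : list R) n : length x = n -> firstn n (x ++ y) = x.
Proof. intros <-. rewrite firstn_app, Nat.sub_diag, firstn_all. cbn. apply app_nil_r. Qed.

(* An index [i >= n] selects the junk value [0] of [nth], hence the case split
   in the polynomials. *)
Lemma definable_select M k (A : list R -> Prop) (hA : Def M k A) n (l : list nat) :
  length l = k -> definable M n (fun x => A (select l x)).
Proof.
  intros Hl.
  set (eqn := fun j => PAdd (PVar (n + j))
     (PMul (PConst (-1)) (if Nat.ltb (nth j l 0%nat) n then PVar (nth j l 0%nat) else PConst 0))).
  assert (Heqn : forall x y j, length x = n ->
     (peval (eqn j) (x ++ y) = 0 <-> nth j y 0 = nth (nth j l 0%nat) x 0)).
  { intros x y j Hx. cbn [peval eqn].
    rewrite app_nth2 by lia.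
    replace (n + j - length x)%nat with j by lia.
    destruct (Nat.ltb_spec (nth j l 0%nat) n) as [H|H]; cbn [peval].
    - rewrite app_nth1 by lia. split; intros; lra.
    - rewrite (nth_overflow x) by lia. split; intros; lra. }
  (* These are the points of the product of [R^n] (the algebraic set without equations) and [A] that
     satisfy the linear equations [eqn]. Projecting away the last [k] coordinates leaves the
     preimage of [A]. *)
  assert (H : definable M (n + k) (fun z => exists x y, z = x ++ y /\ length x = n /\
      A y /\ Forall (fun j => nth j y 0 = nth (nth j l 0%nat) x 0) (seq 0 k))).
  { eapply Def_ext.
    { apply Def_inter; [apply (Def_prod M n k _ _ (Def_algebraic M n []) hA)|].
      apply (Def_algebraic M (n + k) (map eqn (seq 0 k))). }
    intros z; unfold algebraic_set; cbn; split.
    - intros [[x [y [-> [[Hx _] Hy]]]] [Hz Hf]]. split; trivial.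
      exists x, y. rewrite Forall_map in Hf. repeat split; trivial.
      eapply Forall_impl; [|exact Hf]. cbn. intros j. now apply Heqn.
    - intros [Hz [x [y [-> [Hx [Hy Hf]]]]]]. split; [|split; trivial].
      + exists x, y. repeat split; trivial.
      + rewrite Forall_map. eapply Forall_impl; [|exact Hf]. cbn. intros j. now apply Heqn. }
  eapply definable_ext; [apply definable_exists_block; exact H|].
  intros x Hx; cbn; split.
  - intros [y [Hy [x' [y' [E [Hx' [Ay Hf]]]]]]].
    assert (x = x').
    { rewrite <- (firstn_app_exact x y n Hx), E. now apply firstn_app_exact. }
    subst x'. apply app_inv_head in E. subst y'.
    replace (select l x) with y; trivial.
    apply nth_ext with (d := 0) (d' := nth 0%nat x 0); unfold select.
    { now rewrite length_map, Hl. }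
    intros j Hj. rewrite (map_nth (fun i => nth i x 0)).
    rewrite Forall_forall in Hf. apply Hf, in_seq. lia.
  - intros HA. exists (select l x).
    assert (Hs : length (select l x) = k) by (unfold select; now rewrite length_map).
    split; trivial. exists x, (select l x). repeat split; trivial.
    apply Forall_forall. intros j Hj. apply in_seq in Hj. unfold select.
    rewrite nth_indep with (d' := nth 0%nat x 0) by (rewrite length_map; lia).
    apply (map_nth (fun i => nth i x 0)).
Qed.

Lemma definable_poly M n (P : rpoly) : definable M n (fun x => peval P x = 0).
Proof.
  eapply Def_ext; [apply (Def_algebraic M n [P])|].
  intros x; unfold algebraic_set; split; intros [Hx H]; split; trivial.
  - now inversion H.
  - now constructor.
Qed.

Definition definable_val (M : OMinimalStructure) (n : nat) (F : list R -> R) : Prop :=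
  definable M (S n) (fun z => nth n z 0 = F (firstn n z)).

(** The graph of [F] is pulled back along the coordinates [0, ..., n-1, i], so the value may sit
    anywhere in a larger space. *)
Lemma definable_val_at M n F : definable_val M n F -> forall N i, (n <= N)%nat ->
  definable M N (fun z => nth i z 0 = F (firstn n z)).
Proof.
  intros HF N i HN.
  eapply definable_ext.
  { apply (definable_select M _ _ HF N (seq 0 n ++ [i])).
    rewrite length_app, length_seq. cbn. lia. }
  intros x Hx. cbn beta.
  assert (E : select (seq 0 n ++ [i]) x = firstn n x ++ [nth i x 0]).
  { unfold select. rewrite map_app. cbn. f_equal. apply select_firstn. lia. }
  assert (Hf : length (firstn n x) = n) by (apply firstn_length_le; lia).
  rewrite E, length_app, Hf. cbn.
  rewrite app_nth2, Hf, Nat.sub_diag by lia. cbn.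
  rewrite firstn_app, Hf, Nat.sub_diag. cbn. rewrite app_nil_r.
  rewrite firstn_firstn, Nat.min_id. intuition lia.
Qed.

Lemma nth_app_add (x y : list R) n j : length x = n -> nth (n + j) (x ++ y) 0 = nth j y 0.
Proof. intros <-. rewrite app_nth2 by lia. f_equal. lia. Qed.

(** Composition is a projection: auxiliary coordinates hold the values of [F] and [G]. The first
    argument of [Q] serves for graphs of operations; atomic relations ignore it. *)
Lemma definable_val_subst2 M n F G (Q : R -> R -> R -> Prop) :
  definable_val M n F -> definable_val M n G ->
  (forall N i j k, definable M N (fun z => Q (nth i z 0) (nth j z 0) (nth k z 0))) ->
  forall N i, (n <= N)%nat ->
  definable M N (fun z => Q (nth i z 0) (F (firstn n z)) (G (firstn n z))).
Proof.
  intros HF HG HQ N i HN.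
  eapply definable_ext.
  { apply (definable_exists_block M 3).
    apply definable_and; [apply (definable_val_at _ _ _ HF (N + 3) (N + 0)); lia|].
    apply definable_and; [apply (definable_val_at _ _ _ HG (N + 3) (N + 1)); lia|].
    apply definable_and.
    (* The third witness copies coordinate [i]: read directly, an index [i >= N] would hit a witness
       instead of the junk value [0]. *)
    - apply (HQ (N + 3)%nat (N + 2)%nat (N + 0)%nat (N + 1)%nat).
    - apply (definable_poly M (N + 3) (PAdd (PVar (N + 2))
        (PMul (PConst (-1)) (if Nat.ltb i N then PVar i else PConst 0)))). }
  intros x Hx; cbn beta.
  assert (E : forall y, firstn n (x ++ y) = firstn n x).
  { intros y. rewrite firstn_app. replace (n - length x)%nat with 0%nat by lia.
    cbn. apply app_nil_r. }
  assert (E' : forall y, peval (if Nat.ltb i N then PVar i else PConst 0) (x ++ y) = nth i x 0).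
  { intros y. destruct (Nat.ltb_spec i N); cbn.
    - apply app_nth1. lia.
    - symmetry. apply nth_overflow. lia. }
  setoid_rewrite E. cbn [peval]. setoid_rewrite E'.
  setoid_rewrite (fun y j => nth_app_add x y N j Hx). split.
  - intros [y [Hy [H1 [H2 [H3 H4]]]]]. replace (nth i x 0) with (nth 2 y 0) by lra.
    now rewrite <- H1, <- H2.
  - intros H. exists [F (firstn n x); G (firstn n x); nth i x 0]. cbn.
    repeat split; trivial. lra.
Qed.

(* Variables are de Bruijn levels: inside [x ++ [t]] the bound variable [t] has
   index [length x], so that terms need no shifting under binders. *)
Inductive term (M : OMinimalStructure) : Type :=
| TVar : nat -> term M
| TConst : R -> term M
| TAdd : term M -> term M -> term M
| TMul : term M -> term M -> term M
| TFun : forall g : R -> R, definable_fun1 M g -> term M -> term M.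

Arguments TVar {M}. Arguments TConst {M}. Arguments TAdd {M}. Arguments TMul {M}.
Arguments TFun {M}.

Fixpoint teval {M} (t : term M) (x : list R) : R :=
  match t with
  | TVar i => nth i x 0
  | TConst c => c
  | TAdd s t => teval s x + teval t x
  | TMul s t => teval s x * teval t x
  | TFun g _ t => g (teval t x)
  end.

Lemma definable_fun1_select M g (hg : definable_fun1 M g) n i j :
  definable M n (fun z => nth i z 0 = g (nth j z 0)).
Proof.
  eapply definable_ext; [apply (definable_select M 2 _ hg n [j; i] eq_refl)|].
  intros x _; cbn; split.
  - intros [t E]. injection E as -> ->. reflexivity.
  - intros ->. eauto.
Qed.

Lemma definable_val_teval M (t : term M) n : definable_val M n (teval t).
Proof.
  induction t as [i|c|s IHs t IHt|s IHs t IHt|g hg t IHt]; unfold definable_val.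
  - eapply definable_ext;
      [apply (definable_poly M (S n) (PAdd (PVar n) (PMul (PConst (-1))
         (if Nat.ltb i n then PVar i else PConst 0))))|].
    intros x Hx. cbn [teval peval].
    replace (nth i (firstn n x) 0) with (peval (if Nat.ltb i n then PVar i else PConst 0) x).
    + split; intros; lra.
    + destruct (Nat.ltb_spec i n); cbn.
      * rewrite <- (firstn_skipn n x) at 1. apply app_nth1.
        rewrite firstn_length_le; lia.
      * symmetry. apply nth_overflow. rewrite firstn_length_le; lia.
  - eapply definable_ext;
      [apply (definable_poly M (S n) (PAdd (PVar n) (PConst (-c))))|].
    intros x Hx. cbn. split; intros; lra.
  - apply (definable_val_subst2 M n (teval s) (teval t) (fun a b c => a = b + c)); trivial; [|lia].
    intros N i j k. eapply definable_ext;
      [apply (definable_poly M N (PAdd (PVar i) (PMul (PConst (-1)) (PAdd (PVar j) (PVar k)))))|].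
    intros x _; cbn; split; intros; lra.
  - apply (definable_val_subst2 M n (teval s) (teval t) (fun a b c => a = b * c)); trivial; [|lia].
    intros N i j k. eapply definable_ext;
      [apply (definable_poly M N (PAdd (PVar i) (PMul (PConst (-1)) (PMul (PVar j) (PVar k)))))|].
    intros x _; cbn; split; intros; lra.
  - apply (definable_val_subst2 M n (teval t) (teval t) (fun a b c => a = g b)); trivial; [|lia].
    intros N i j k. now apply definable_fun1_select.
Qed.

(** Formulas are reified so that one induction proves definability once and for all; a concrete
    condition is then usually recognized by conversion with [sat]. *)
Inductive form (M : OMinimalStructure) : Type :=
| FEq : term M -> term M -> form M
| FLt : term M -> term M -> form M
| FRel : forall A (l : list nat), Def M (length l) A -> form M
| FNot : form M -> form M
| FAnd : form M -> form M -> form M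
| FOr : form M -> form M -> form M
| FImp : form M -> form M -> form M
| FEx : form M -> form M
| FAll : form M -> form M.

Arguments FEq {M}. Arguments FLt {M}. Arguments FRel {M}. Arguments FNot {M}.
Arguments FAnd {M}. Arguments FOr {M}. Arguments FImp {M}. Arguments FEx {M}.
Arguments FAll {M}.

Fixpoint sat {M} (F : form M) (x : list R) : Prop :=
  match F with
  | FEq s t => teval s x = teval t x
  | FLt s t => teval s x < teval t x
  | FRel A l _ => A (select l x)
  | FNot F => ~ sat F x
  | FAnd F G => sat F x /\ sat G x
  | FOr F G => sat F x \/ sat G x
  | FImp F G => sat F x -> sat G x
  | FEx F => exists t, sat F (x ++ [t])
  | FAll F => forall t, sat F (x ++ [t])
  end.

(* Positivity is existential over the field operations: [0 < u] iff [u * w * w = 1]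
   for some [w]. *)
Lemma definable_lt M n i j : definable M n (fun z => nth i z 0 < nth j z 0).
Proof.
  eapply definable_ext.
  { apply (definable_exists M n), (definable_poly M (S n) (PAdd (PConst (-1))
      (PMul (PAdd (if Nat.ltb j n then PVar j else PConst 0)
        (PMul (PConst (-1)) (if Nat.ltb i n then PVar i else PConst 0)))
        (PMul (PVar n) (PVar n))))). }
  intros x Hx.
  assert (E' : forall i t, peval (if Nat.ltb i n then PVar i else PConst 0) (x ++ [t]) = nth i x 0).
  { intros k y. destruct (Nat.ltb_spec k n); cbn.
    - apply app_nth1. lia.
    - symmetry. apply nth_overflow. lia. }
  cbn [peval]. setoid_rewrite E'.
  assert (E : forall t, nth n (x ++ [t]) 0 = t).
  { intros t. rewrite <- (Nat.add_0_r n). now apply nth_app_add. }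
  setoid_rewrite E.
  generalize (nth i x 0) (nth j x 0). clear. intros a b. split.
  - intros [t H]. destruct (Rlt_le_dec a b) as [|Hab]; trivial.
    assert (0 <= t * t) by apply Rle_0_sqr. nra.
  - intros H. exists (/ sqrt (b - a)).
    assert (Hs : 0 < sqrt (b - a)) by (apply sqrt_lt_R0; lra).
    assert (Hq : sqrt (b - a) * sqrt (b - a) = b - a) by (apply sqrt_sqrt; lra).
    replace (b + -1 * a) with (sqrt (b - a) * sqrt (b - a)) by lra. field. lra.
Qed.

(** The dimension [n] is arbitrary, not a bound on the free variables: a variable out of range
    evaluates to [0], so the induction carries no well-formedness condition. *)
Theorem definable_sat M (F : form M) : forall n, definable M n (sat F).
Proof.
  assert (Hall : forall n (x : list R), length x = n -> firstn n x = x)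
    by (intros n x <-; apply firstn_all).
  induction F as [s t|s t|A l hA|F IHF|F IHF G IHG|F IHF G IHG|F IHF G IHG|F IHF|F IHF];
    intros n; cbn [sat].
  - eapply definable_ext.
    { refine (definable_val_subst2 M n (teval s) (teval t) (fun _ b c => b = c)
        (definable_val_teval M s n) (definable_val_teval M t n) _ n 0%nat _); [|lia].
      intros N i j k. eapply definable_ext;
        [apply (definable_poly M N (PAdd (PVar j) (PMul (PConst (-1)) (PVar k))))|].
      intros x _; cbn; split; intros; lra. }
    intros x Hx. cbn beta. rewrite (Hall n x Hx). reflexivity.
  - eapply definable_ext.
    { refine (definable_val_subst2 M n (teval s) (teval t) (fun _ b c => b < c)
        (definable_val_teval M s n) (definable_val_teval M t n) _ n 0%nat _); [|lia].
      intros N i j k. apply definable_lt. }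
    intros x Hx. cbn beta. rewrite (Hall n x Hx). reflexivity.
  - now apply (definable_select M (length l)).
  - now apply definable_not.
  - now apply definable_and.
  - now apply definable_or.
  - eapply definable_ext;
      [apply (definable_or _ _ _ _ (definable_not _ _ _ (IHF n)) (IHG n))|].
    intros x _; cbn. destruct (classic (sat F x)); tauto.
  - now apply definable_exists.
  - eapply definable_ext;
      [apply definable_not, definable_exists, definable_not, (IHF (S n))|].
    intros x _; cbn; split.
    + intros H t. apply NNPP. eauto.
    + intros H [t Ht]. auto.
Qed.

Definition definable_pred (M : OMinimalStructure) (P : R -> Prop) : Prop :=
  Def M 1 (fun x => exists t, x = [t] /\ P t).

Lemma definable_pred_sat M (F : form M) (P : R -> Prop) :
  (forall t, sat F [t] <-> P t) -> definable_pred M P.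
Proof.
  intros H. eapply Def_ext; [apply (definable_sat M F 1)|].
  intros x; cbn; split.
  - intros [Hx Hs]. destruct x as [|t [|]]; try discriminate. exists t. split; trivial. now apply H.
  - intros [t [-> Ht]]. split; trivial. now apply H.
Qed.

Lemma definable_fun1_sat M (F : form M) (g : R -> R) :
  (forall t y, sat F [t; y] <-> y = g t) -> definable_fun1 M g.
Proof.
  intros H. eapply Def_ext; [apply (definable_sat M F 2)|].
  intros x; cbn; split.
  - intros [Hx Hs]. destruct x as [|t [|y [|]]]; try discriminate.
    exists t. apply H in Hs. now rewrite Hs.
  - intros [t ->]. split; trivial. now apply H.
Qed.

Lemma definable_fun1_teval M (T : term M) : definable_fun1 M (fun t => teval T [t]).
Proof.
  pose proof (definable_val_teval M T 1) as H. unfold definable_val, definable in H.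
  eapply Def_ext; [exact H|]. intros x; cbn; split.
  - intros [Hx Hs]. destruct x as [|t [|y [|]]]; try discriminate.
    exists t. cbn in Hs. now rewrite Hs.
  - intros [t ->]. split; trivial.
Qed.

Lemma definable_fun1_opp M : definable_fun1 M Ropp.
Proof.
  apply (definable_fun1_sat M (FEq (TAdd (TVar 0) (TVar 1)) (TConst 0))).
  intros t y; cbn; split; intros; lra.
Qed.

Definition TSub {M} (s t : term M) : term M := TAdd s (TFun Ropp (definable_fun1_opp M) t).

(** * Right germs *)

Definition right_germ (x : R) (P : R -> Prop) : Prop :=
  exists d, 0 < d /\ forall t, x < t < x + d -> P t.

Lemma right_germ_and x (P Q : R -> Prop) :
  right_germ x P -> right_germ x Q -> right_germ x (fun t => P t /\ Q t).
Proof.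
  intros [d [Hd HP]] [e [He HQ]]. exists (Rmin d e). split; [now apply Rmin_pos|].
  intros t Ht. pose proof (Rmin_l d e). pose proof (Rmin_r d e).
  split; [apply HP|apply HQ]; lra.
Qed.

Lemma right_germ_impl x (P Q : R -> Prop) :
  (forall t, x < t -> P t -> Q t) -> right_germ x P -> right_germ x Q.
Proof.
  intros H [d [Hd HP]]. exists d. split; trivial. intros t Ht. apply H; [lra|auto].
Qed.

Lemma right_germ_false x : ~ right_germ x (fun _ => False).
Proof. intros [d [Hd H]]. apply (H (x + d / 2)). lra. Qed.

Lemma right_germ_lt x y : x < y -> right_germ x (fun t => t < y).
Proof. intros H. exists (y - x). split; [lra|]. intros; lra. Qed.

Lemma right_germ_all x (P : R -> Prop) : (forall t, x < t -> P t) -> right_germ x P.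
Proof. intros H. exists 1. split; [lra|]. intros; apply H; lra. Qed.

Lemma in_cell_germ c x :
  right_germ x (in_cell c) \/ right_germ x (fun t => ~ in_cell c t).
Proof.
  destruct c as [a|lo hi].
  - right. destruct (Rlt_le_dec x a) as [H|H].
    + eapply right_germ_impl; [|apply (right_germ_lt x a H)]. cbn. intros; lra.
    + apply right_germ_all. cbn. intros; lra.
  - assert (Hlo : right_germ x (fun t => match lo with Some a => a < t | None => True end)
      \/ right_germ x (fun t => ~ match lo with Some a => a < t | None => True end)).
    { destruct lo as [a|]; [|left; now apply right_germ_all].
      destruct (Rlt_le_dec x a) as [H|H].
      - right. eapply right_germ_impl; [|apply (right_germ_lt x a H)]. cbn. intros; lra.
      - left. apply right_germ_all. intros; lra. }
    assert (Hhi : right_germ x (fun t => match hi with Some a => t < a | None => True end)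
      \/ right_germ x (fun t => ~ match hi with Some a => t < a | None => True end)).
    { destruct hi as [a|]; [|left; now apply right_germ_all].
      destruct (Rlt_le_dec x a) as [H|H].
      - left. now apply right_germ_lt.
      - right. apply right_germ_all. intros; lra. }
    destruct Hlo as [Hlo|Hlo].
    + destruct Hhi as [Hhi|Hhi].
      * left. now apply right_germ_and.
      * right. eapply right_germ_impl; [|exact Hhi]. cbn. tauto.
    + right. eapply right_germ_impl; [|exact Hlo]. cbn. tauto.
Qed.

(** Each cell contains or misses an interval to the right of [x], hence so does a finite union of
    cells. This is the one place where the description of the definable subsets of the line
    enters. *)
Lemma definable_pred_germ M P x :
  definable_pred M P -> right_germ x P \/ right_germ x (fun t => ~ P t).
Proof.
  intros H. apply Def_one in H. destruct H as [cs Hcs].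
  assert (HP : forall t, P t <-> Exists (fun c => in_cell c t) cs).
  { intros t. specialize (Hcs [t]). split.
    - intros Ht. destruct (proj1 Hcs) as [t' [E H]]; [eauto|]. now injection E as <-.
    - intros Ht. destruct (proj2 Hcs) as [t' [E H]]; [eauto|]. now injection E as <-. }
  clear Hcs.
  assert (D : right_germ x (fun t => Exists (fun c => in_cell c t) cs) \/
              right_germ x (fun t => ~ Exists (fun c => in_cell c t) cs)).
  { clear HP. induction cs as [|c cs IH].
    - right. apply right_germ_all. intros t _ H. inversion H.
    - destruct (in_cell_germ c x) as [H|H].
      { left. eapply right_germ_impl; [|exact H]. intros t _. now constructor. }
      destruct IH as [IH|IH].
      { left. eapply right_germ_impl; [|exact IH]. intros t _. now constructor. }
      right. eapply right_germ_impl; [|apply (right_germ_and _ _ _ H IH)].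
      cbn. intros t _ [H1 H2] H3. inversion H3; auto. }
  destruct D as [D|D]; [left|right]; eapply right_germ_impl; try exact D;
    intros t _; rewrite HP; auto.
Qed.

(** * Generic continuity of definable functions *)

(** Both endpoints move strictly at each step, so the supremum of the left endpoints is interior to
    every interval. The sequence is chosen in the type [T] of nondegenerate subintervals. *)
Lemma nested_intervals (A B : R) (Q : nat -> R -> R -> Prop) :
  A < B ->
  (forall n a b, A <= a -> a < b -> b <= B ->
     exists c d, a < c /\ c < d /\ d < b /\ Q n c d) ->
  exists x, A < x < B /\ forall n, exists c d, c < x < d /\ Q n c d.
Proof.
  intros HAB HQ.
  set (T := {ab : R * R | A <= fst ab /\ fst ab < snd ab /\ snd ab <= B}).
  assert (step : forall n (I : T), {J : T |
     fst (proj1_sig I) < fst (proj1_sig J) /\ snd (proj1_sig J) < snd (proj1_sig I) /\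
     Q n (fst (proj1_sig J)) (snd (proj1_sig J))}).
  { intros n [[a b] HI]. cbn in *. apply constructive_indefinite_description.
    destruct (HQ n a b) as [c [d H]]; try tauto.
    assert (HJ : A <= fst (c, d) /\ fst (c, d) < snd (c, d) /\ snd (c, d) <= B) by (cbn; lra).
    exists (exist _ (c, d) HJ). cbn. tauto. }
  assert (H0 : A <= fst (A, B) /\ fst (A, B) < snd (A, B) /\ snd (A, B) <= B) by (cbn; lra).
  set (I := fix I n : T := match n with 0%nat => exist _ (A, B) H0
                            | S k => proj1_sig (step k (I k)) end).
  set (l := fun n => fst (proj1_sig (I n))). set (r := fun n => snd (proj1_sig (I n))).
  assert (Hstep : forall n, l n < l (S n) /\ r (S n) < r n /\ Q n (l (S n)) (r (S n)))
    by (intros n; exact (proj2_sig (step n (I n)))).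
  assert (Hlr : forall n, l n < r n) by (intros n; apply (proj2_sig (I n))).
  assert (Hmono : forall n k, l n <= l (n + k)%nat /\ r (n + k)%nat <= r n).
  { intros n k. induction k as [|k IH].
    - rewrite Nat.add_0_r. lra.
    - rewrite Nat.add_succ_r. destruct (Hstep (n + k)%nat). lra. }
  assert (Hlt : forall n k, l n < r k).
  { intros n k. destruct (Hmono n k) as [H1 _]. destruct (Hmono k n) as [_ H2].
    rewrite Nat.add_comm in H2. specialize (Hlr (n + k)%nat). lra. }
  destruct (completeness (fun y => exists n, y = l n)) as [x [Hub Hlub]].
  { exists (r 0%nat). intros y [n ->]. left. apply Hlt. }
  { exists (l 0%nat). now exists 0%nat. }
  assert (Hin : forall n, l n < x < r n).
  { intros n. destruct (Hstep n) as [H1 [H2 _]]. split.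
    - eapply Rlt_le_trans; [exact H1|]. apply Hub. eauto.
    - eapply Rle_lt_trans; [|exact H2]. apply Hlub. intros y [k ->]. left. apply Hlt. }
  exists x. split; [exact (Hin 0%nat)|].
  intros n. exists (l (S n)), (r (S n)). split; [apply Hin|apply Hstep].
Qed.

Lemma definable_pred_ge M g (hg : definable_fun1 M g) c :
  definable_pred M (fun t => ~ g t < c).
Proof.
  apply (definable_pred_sat M (FNot (FLt (TFun g hg (TVar 0)) (TConst c)))). reflexivity.
Qed.

(** Either [g] is bounded to the right of some point, and then has a finite limit there, or by the
    dichotomy [|g|] exceeds every constant to the right of every point, which nested intervals
    refute. *)
Lemma small_oscillation M g (hg : definable_fun1 M g) a b eta :
  a < b -> 0 < eta -> exists c d, a < c /\ c < d /\ d < b /\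
    forall s t, c < s < d -> c < t < d -> g s - g t < eta.
Proof.
  intros Hab Heta.
  destruct (classic (exists x K, a < x < b /\
    right_germ x (fun t => ~ g t < - K /\ ~ K < g t))) as [[x [K [Hx HK]]]|Hno].
  (* The right limit [L] of [g] at [x] is the supremum of the lower bounds valid to the right of
     [x]. *)
  - destruct (completeness (fun c => right_germ x (fun t => ~ g t < c))) as [L [Hub Hlub]].
    { exists K. intros c Hc. apply Rnot_lt_le. intros Hlt.
      apply (right_germ_false x).
      eapply right_germ_impl; [|apply (right_germ_and _ _ _ HK Hc)]. cbn. intros; lra. }
    { exists (- K). eapply right_germ_impl; [|exact HK]. cbn. tauto. }
    assert (H1 : right_germ x (fun t => L - eta / 3 < g t)).
    { apply NNPP. intros Hn.
      assert (L <= L - eta / 3); [|lra]. apply Hlub. intros c Hc.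
      apply Rnot_lt_le. intros Hlt. apply Hn.
      eapply right_germ_impl; [|exact Hc]. cbn. intros; lra. }
    assert (H2 : right_germ x (fun t => g t < L + eta / 3)).
    { destruct (definable_pred_germ M _ x (definable_pred_ge M g hg (L + eta / 3))) as [H|H].
      - apply Hub in H. lra.
      - eapply right_germ_impl; [|exact H]. cbn. intros; now apply NNPP. }
    destruct (right_germ_and _ _ _ (right_germ_and _ _ _ H1 H2)
      (right_germ_lt x b (proj2 Hx))) as [d [Hd H]].
    exists (x + d / 3), (x + d / 2).
    repeat split; try lra.
    + apply H. lra.
    + intros s t Hs Ht. pose proof (H s). pose proof (H t). lra.
  - exfalso.
    assert (Hbig : forall x K, a < x < b -> right_germ x (fun t => ~ (~ g t < - K /\ ~ K < g t))).
    { intros x K Hx.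
      destruct (definable_pred_germ M (fun t => ~ g t < - K /\ ~ K < g t) x) as [H|H]; trivial.
      - apply (definable_pred_sat M (FAnd (FNot (FLt (TFun g hg (TVar 0)) (TConst (- K))))
          (FNot (FLt (TConst K) (TFun g hg (TVar 0)))))). reflexivity.
      - exfalso. eauto. }
    (* With [|g| > n] on the [n]-th interval, the common point would have an infinite value. *)
    destruct (nested_intervals a b (fun n c d => forall t, c < t < d ->
      ~ (~ g t < - INR n /\ ~ INR n < g t)) Hab) as [x [Hx H]].
    { intros n a' b' Ha' Hab' Hb'.
      destruct (Hbig ((a' + b') / 2) (INR n)) as [d [Hd H]]; [lra|].
      set (e := Rmin d ((b' - a') / 2)).
      assert (He : 0 < e) by (apply Rmin_pos; lra).
      assert (e <= d) by apply Rmin_l. assert (e <= (b' - a') / 2) by apply Rmin_r.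
      exists ((a' + b') / 2 + e / 3), ((a' + b') / 2 + e / 2).
      repeat split; try lra. intros t Ht. apply H. lra. }
    destruct (INR_unbounded (Rabs (g x))) as [n Hn].
    destruct (H n) as [c [d [Hcd Hc]]]. apply (Hc x Hcd).
    unfold Rabs in Hn. destruct (Rcase_abs (g x)); lra.
Qed.

(** Absolute values are avoided so that the condition is convertible with a formula. *)
Definition cont_at (g : R -> R) (t : R) : Prop :=
  forall eta, 0 < eta -> exists delta, 0 < delta /\
    forall s, t - delta < s /\ s < t + delta -> g t - eta < g s /\ g s < g t + eta.

(** A point common to intervals on which [g] oscillates by less than [1/(n+1)] is a point of
    continuity. *)
Lemma definable_cont_point M g (hg : definable_fun1 M g) a b :
  a < b -> exists x, a < x < b /\ cont_at g x.
Proof.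
  intros Hab.
  destruct (nested_intervals a b (fun n c d => forall s t, c < s < d -> c < t < d ->
     g s - g t < / (INR n + 1)) Hab) as [x [Hx H]].
  { intros n a' b' _ Hab' _. apply (small_oscillation M g hg a' b'); trivial.
    apply Rinv_0_lt_compat. pose proof (pos_INR n). lra. }
  exists x. split; trivial. intros eta Heta.
  destruct (INR_unbounded (/ eta)) as [n Hn].
  assert (Hn' : / (INR n + 1) < eta).
  { rewrite <- (Rinv_inv eta). apply Rinv_lt_contravar; [|lra].
    assert (0 < / eta) by now apply Rinv_0_lt_compat. nra. }
  destruct (H n) as [c [d [Hcd Hc]]].
  exists (Rmin (x - c) (d - x)). split; [apply Rmin_pos; lra|].
  intros s Hs. pose proof (Rmin_l (x - c) (d - x)). pose proof (Rmin_r (x - c) (d - x)).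
  pose proof (Hc s x ltac:(lra) Hcd). pose proof (Hc x s Hcd ltac:(lra)). lra.
Qed.

Lemma definable_pred_cont_at M g (hg : definable_fun1 M g) : definable_pred M (cont_at g).
Proof.
  apply (definable_pred_sat M
    (FAll (FImp (FLt (TConst 0) (TVar 1)) (FEx (FAnd (FLt (TConst 0) (TVar 2))
      (FAll (FImp (FAnd (FLt (TSub (TVar 0) (TVar 2)) (TVar 3))
                        (FLt (TVar 3) (TAdd (TVar 0) (TVar 2))))
        (FAnd (FLt (TSub (TFun g hg (TVar 0)) (TVar 1)) (TFun g hg (TVar 3)))
              (FLt (TFun g hg (TVar 3)) (TAdd (TFun g hg (TVar 0)) (TVar 1))))))))))).
  reflexivity.
Qed.

Lemma definable_cont_germ M g (hg : definable_fun1 M g) : right_germ 0 (cont_at g).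
Proof.
  destruct (definable_pred_germ M _ 0 (definable_pred_cont_at M g hg)) as [H|[d [Hd H]]]; trivial.
  destruct (definable_cont_point M g hg 0 d Hd) as [x [Hx Hc]].
  exfalso. apply (H x); [lra|trivial].
Qed.

(** * Generic differentiability of definable functions *)

(** A mean value inequality with one-sided slopes: the supremum [s] of the points satisfying the
    inequality satisfies it by continuity, and the slope condition pushes past [s] unless
    [s = d]. *)
Lemma increment_ge (g : R -> R) K c d : c < d ->
  (forall t, c <= t <= d -> cont_at g t) ->
  (forall t, c <= t < d -> exists delta, 0 < delta /\
     forall h, 0 < h /\ h < delta -> K * h < g (t + h) - g t) ->
  K * (d - c) <= g d - g c.
Proof.
  intros Hcd Hcont Hright.
  destruct (completeness (fun t => c <= t <= d /\ K * (t - c) <= g t - g c)) as [s [Hub Hlub]].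
  { exists d. intros t Ht. lra. }
  { exists c. lra. }
  assert (Hs : c <= s <= d).
  { split; [apply Hub; lra|]. apply Hlub. intros t Ht. lra. }
  assert (Es : K * (s - c) <= g s - g c).
  { apply Rnot_lt_le. intros Hlt.
    set (eta := K * (s - c) - (g s - g c)).
    assert (Heta : 0 < eta) by (unfold eta; lra).
    destruct (Hcont s Hs (eta / 2)) as [d1 [Hd1 H1]]; [lra|].
    (* Within [d2] of [s] the linear term changes by less than [eta / 2], and within [d1] so does
       [g]. Hence no point that close on the left of [s] satisfies the inequality, and [s] is not
       the supremum. *)
    set (d2 := eta / 2 / (Rabs K + 1)).
    assert (HK : 0 < Rabs K + 1) by (pose proof (Rabs_pos K); lra).
    assert (Hd2 : 0 < d2) by (apply Rdiv_lt_0_compat; lra).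
    assert (Ed2 : d2 * (Rabs K + 1) = eta / 2) by (unfold d2; field; lra).
    assert (Hd : 0 < Rmin d1 d2) by now apply Rmin_pos.
    assert (Hm1 : Rmin d1 d2 <= d1) by apply Rmin_l.
    assert (Hm2 : Rmin d1 d2 <= d2) by apply Rmin_r.
    assert (s <= s - Rmin d1 d2); [|lra].
    apply Hlub. intros t [Ht Et]. apply Rnot_lt_le. intros Hst.
    assert (t <= s) by (apply Hub; auto).
    destruct (H1 t) as [_ H2]; [lra|].
    assert (K * (s - t) <= Rabs K * (s - t)).
    { apply Rmult_le_compat_r; [lra|]. apply Rle_abs. }
    assert (Rabs K * (s - t) <= (Rabs K + 1) * (s - t)) by nra.
    assert ((Rabs K + 1) * (s - t) < eta / 2).
    { rewrite <- Ed2, Rmult_comm. apply Rmult_lt_compat_r; lra. }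
    unfold eta in *. nra. }
  destruct (Rle_lt_or_eq_dec s d (proj2 Hs)) as [Hsd|<-]; trivial.
  exfalso. destruct (Hright s) as [delta [Hdelta H]]; [lra|].
  set (h := Rmin delta (d - s) / 2).
  assert (0 < Rmin delta (d - s)) by (apply Rmin_pos; lra).
  assert (Rmin delta (d - s) <= delta) by apply Rmin_l.
  assert (Rmin delta (d - s) <= d - s) by apply Rmin_r.
  assert (Hh : 0 < h /\ h < delta) by (unfold h; lra).
  specialize (H h Hh).
  assert (s + h <= s); [|lra]. apply Hub. split; [unfold h in *; lra|]. nra.
Qed.

Lemma cont_at_opp g t : cont_at g t -> cont_at (fun s => - g s) t.
Proof.
  intros H eta Heta. destruct (H eta Heta) as [d [Hd Hs]].
  exists d. split; trivial. intros s Hst. specialize (Hs s Hst). lra.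
Qed.

Lemma increment_le (g : R -> R) K c d : c < d ->
  (forall t, c <= t <= d -> cont_at g t) ->
  (forall t, c <= t < d -> exists delta, 0 < delta /\
     forall h, 0 < h /\ h < delta -> g (t + h) - g t < K * h) ->
  g d - g c <= K * (d - c).
Proof.
  intros Hcd Hc Hr.
  assert (- K * (d - c) <= - g d - - g c); [|lra].
  apply (increment_ge (fun s => - g s)); trivial.
  - intros t Ht. now apply cont_at_opp, Hc.
  - intros t Ht. destruct (Hr t Ht) as [e [He H]]. exists e. split; trivial.
    intros h Hh. specialize (H h Hh). lra.
Qed.

(** The difference quotient is cleared of its positive denominator [h], which makes the condition a
    formula without division. *)
Definition rderiv (g : R -> R) (t L : R) : Prop :=
  forall eta, 0 < eta -> exists delta, 0 < delta /\
    forall h, 0 < h /\ h < delta ->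
      (L - eta) * h < g (t + h) - g t /\ g (t + h) - g t < (L + eta) * h.

Definition rderiv_pinf (g : R -> R) (t : R) : Prop :=
  forall K, exists delta, 0 < delta /\
    forall h, 0 < h /\ h < delta -> K * h < g (t + h) - g t.

Definition rderiv_ninf (g : R -> R) (t : R) : Prop :=
  forall K, exists delta, 0 < delta /\
    forall h, 0 < h /\ h < delta -> g (t + h) - g t < K * h.

Lemma rderiv_unique g t L1 L2 : rderiv g t L1 -> rderiv g t L2 -> L1 = L2.
Proof.
  assert (H : forall L1 L2, rderiv g t L1 -> rderiv g t L2 -> ~ L1 < L2).
  { intros M1 M2 H1 H2 Hlt.
    destruct (H1 ((M2 - M1) / 2)) as [d1 [Hd1 K1]]; [lra|].
    destruct (H2 ((M2 - M1) / 2)) as [d2 [Hd2 K2]]; [lra|].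
    pose proof (Rmin_l d1 d2). pose proof (Rmin_r d1 d2). pose proof (Rmin_pos d1 d2 Hd1 Hd2).
    specialize (K1 (Rmin d1 d2 / 2) ltac:(lra)). specialize (K2 (Rmin d1 d2 / 2) ltac:(lra)).
    lra. }
  intros H1 H2. destruct (Rtotal_order L1 L2) as [E|[E|E]]; trivial.
  - now apply H in E.
  - now apply H in E.
Qed.

(** The set [E] of eventual lower slopes is closed downwards. It is empty, the whole line, or has a
    finite supremum; these are the slopes [-oo], [+oo] and [L]. *)
Lemma definable_rderiv_cases M g (hg : definable_fun1 M g) t :
  rderiv_pinf g t \/ rderiv_ninf g t \/ exists L, rderiv g t L.
Proof.
  set (E := fun K => right_germ 0 (fun h => ~ g (t + h) - g t < K * h)).
  assert (Hdich : forall K, E K \/ right_germ 0 (fun h => g (t + h) - g t < K * h)).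
  { intros K. destruct (definable_pred_germ M (fun h => ~ g (t + h) - g t < K * h) 0) as [H|H].
    - apply (definable_pred_sat M (FNot (FLt
        (TSub (TFun g hg (TAdd (TConst t) (TVar 0))) (TConst (g t)))
        (TMul (TConst K) (TVar 0))))). reflexivity.
    - now left.
    - right. eapply right_germ_impl; [|exact H]. intros; now apply NNPP. }
  assert (Hgerm : forall P : R -> Prop, right_germ 0 P ->
     exists delta, 0 < delta /\ forall h, 0 < h /\ h < delta -> P h).
  { intros P [d [Hd H]]. exists d. split; trivial. intros h Hh. apply H. lra. }
  destruct (classic (exists K, E K)) as [[K0 HK0]|Hno].
  2:{ right; left. intros K. apply Hgerm. destruct (Hdich K); trivial. exfalso; eauto. }
  destruct (classic (exists K, ~ E K)) as [[K1 HK1]|Hno].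
  2:{ left. intros K. apply Hgerm.
      assert (HE : E (K + 1)) by (apply NNPP; eauto).
      eapply right_germ_impl; [|exact HE]. cbn. intros h Hh H. nra. }
  right; right.
  destruct (completeness E) as [L [Hub Hlub]].
  { exists K1. intros K HK. apply Rnot_lt_le. intros Hlt. apply HK1.
    eapply right_germ_impl; [|exact HK]. cbn. intros h Hh H. nra. }
  { now exists K0. }
  exists L. intros eta Heta. apply Hgerm. apply right_germ_and.
  - apply NNPP. intros Hn. assert (L <= L - eta); [|lra]. apply Hlub. intros K HK.
    apply Rnot_lt_le. intros Hlt. apply Hn.
    eapply right_germ_impl; [|exact HK]. cbn. intros h Hh H. nra.
  - destruct (Hdich (L + eta)) as [H|H]; trivial. apply Hub in H. lra.
Qed.

(** Here [n] counts the variables already in scope; the bound [eta], [delta], [h] get levels [n],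
    [1 + n], [2 + n]. *)
Definition FRderiv {M g} (hg : definable_fun1 M g) (n : nat) (t L : term M) : form M :=
  FAll (FImp (FLt (TConst 0) (TVar n)) (FEx (FAnd (FLt (TConst 0) (TVar (1 + n)))
    (FAll (FImp (FAnd (FLt (TConst 0) (TVar (2 + n))) (FLt (TVar (2 + n)) (TVar (1 + n))))
      (FAnd (FLt (TMul (TSub L (TVar n)) (TVar (2 + n)))
                 (TSub (TFun g hg (TAdd t (TVar (2 + n)))) (TFun g hg t)))
            (FLt (TSub (TFun g hg (TAdd t (TVar (2 + n)))) (TFun g hg t))
                 (TMul (TAdd L (TVar n)) (TVar (2 + n)))))))))).

(* Junk value [0] where the right derivative does not exist. *)
Definition right_derivative (g : R -> R) (t : R) : R :=
  epsilon (inhabits 0) (fun y => rderiv g t y \/ (~ (exists L, rderiv g t L) /\ y = 0)).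

Lemma right_derivative_spec g t :
  rderiv g t (right_derivative g t) \/
  (~ (exists L, rderiv g t L) /\ right_derivative g t = 0).
Proof.
  apply (epsilon_spec (inhabits 0) (fun y => rderiv g t y \/ (~ (exists L, rderiv g t L) /\ y = 0))).
  destruct (classic (exists L, rderiv g t L)) as [[L H]|H]; eauto.
Qed.

Lemma right_derivative_definable M g (hg : definable_fun1 M g) :
  definable_fun1 M (right_derivative g).
Proof.
  apply (definable_fun1_sat M (FOr (FRderiv hg 2 (TVar 0) (TVar 1))
    (FAnd (FNot (FEx (FRderiv hg 3 (TVar 0) (TVar 2)))) (FEq (TVar 1) (TConst 0))))).
  intros t y.
  change (rderiv g t y \/ (~ (exists L, rderiv g t L) /\ y = 0) <-> y = right_derivative g t).
  destruct (right_derivative_spec g t) as [H|[H E]]; split.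
  - intros [H'|[H' _]]; [now apply (rderiv_unique g t)|exfalso; eauto].
  - intros ->. now left.
  - intros [H'|[_ ->]]; [exfalso; eauto|now symmetry].
  - intros ->. right. now split.
Qed.

(** The right derivative cannot be infinite on a whole interval, so near [0+] it is a finite
    definable function, hence continuous there. A continuous function with continuous right
    derivative is differentiable, by the mean value inequalities. *)
Lemma definable_derivable M g (hg : definable_fun1 M g) :
  exists g', definable_fun1 M g' /\ right_germ 0 (fun t => derivable_pt_lim g t (g' t)).
Proof.
  pose proof (definable_cont_germ M g hg) as Hcont.
  assert (Hpinf : right_germ 0 (fun t => ~ rderiv_pinf g t)).
  { destruct (definable_pred_germ M (rderiv_pinf g) 0) as [H|H]; trivial.
    - apply (definable_pred_sat M (FAll (FEx (FAnd (FLt (TConst 0) (TVar 2))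
        (FAll (FImp (FAnd (FLt (TConst 0) (TVar 3)) (FLt (TVar 3) (TVar 2)))
          (FLt (TMul (TVar 1) (TVar 3))
            (TSub (TFun g hg (TAdd (TVar 0) (TVar 3))) (TFun g hg (TVar 0))))))))));
      reflexivity.
    - exfalso. destruct (right_germ_and _ _ _ Hcont H) as [d [Hd H']].
      (* One more than the actual slope between [d / 3] and [d / 2], contradicting a right
         derivative [+oo] throughout. *)
      set (K := (g (d / 2) - g (d / 3)) / (d / 6) + 1).
      assert (K * (d / 2 - d / 3) <= g (d / 2) - g (d / 3)).
      { apply increment_ge; [lra| |].
        - intros t Ht. apply H'. lra.
        - intros t Ht. apply H'. lra. }
      assert (K * (d / 2 - d / 3) = g (d / 2) - g (d / 3) + d / 6)
        by (unfold K; field; lra).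
      lra. }
  assert (Hninf : right_germ 0 (fun t => ~ rderiv_ninf g t)).
  { destruct (definable_pred_germ M (rderiv_ninf g) 0) as [H|H]; trivial.
    - apply (definable_pred_sat M (FAll (FEx (FAnd (FLt (TConst 0) (TVar 2))
        (FAll (FImp (FAnd (FLt (TConst 0) (TVar 3)) (FLt (TVar 3) (TVar 2)))
          (FLt (TSub (TFun g hg (TAdd (TVar 0) (TVar 3))) (TFun g hg (TVar 0)))
            (TMul (TVar 1) (TVar 3)))))))));
      reflexivity.
    - exfalso. destruct (right_germ_and _ _ _ Hcont H) as [d [Hd H']].
      set (K := (g (d / 2) - g (d / 3)) / (d / 6) - 1).
      assert (g (d / 2) - g (d / 3) <= K * (d / 2 - d / 3)).
      { apply increment_le; [lra| |].
        - intros t Ht. apply H'. lra.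
        - intros t Ht. apply H'. lra. }
      assert (K * (d / 2 - d / 3) = g (d / 2) - g (d / 3) - d / 6)
        by (unfold K; field; lra).
      lra. }
  set (g' := right_derivative g).
  pose proof (right_derivative_definable M g hg) as hg'.
  exists g'. split; trivial.
  destruct (right_germ_and _ _ _ (right_germ_and _ _ _ Hpinf Hninf)
    (right_germ_and _ _ _ Hcont (definable_cont_germ M g' hg'))) as [d [Hd H]].
  assert (Hr : forall t, 0 < t < d -> rderiv g t (g' t)).
  { intros t Ht. destruct (H t) as [[H1 H2] _]; [lra|].
    destruct (definable_rderiv_cases M g hg t) as [?|[?|[L HL]]]; try tauto.
    destruct (right_derivative_spec g t) as [?|[Hn _]]; trivial. exfalso; eauto. }
  exists d. split; trivial. intros t Ht eps Heps.
  destruct (H t Ht) as [_ [_ Hc]].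
  destruct (Hc (eps / 3)) as [e [He Hosc]]; [lra|].
  set (r := Rmin e (Rmin t (d - t))).
  assert (Hr0 : 0 < r) by (repeat apply Rmin_pos; lra).
  assert (r <= e) by apply Rmin_l.
  assert (r <= t /\ r <= d - t).
  { split; (eapply Rle_trans; [apply Rmin_r|]); [apply Rmin_l|apply Rmin_r]. }
  (* One [eps / 3] is the oscillation of [g'] near [t], the other the error in the right derivative
     at each point. *)
  assert (Hinc : forall u v, t - r < u -> u < v -> v < t + r ->
    (g' t - 2 * eps / 3) * (v - u) <= g v - g u <= (g' t + 2 * eps / 3) * (v - u)).
  { intros u v Hu Huv Hv. split.
    - apply increment_ge; trivial.
      + intros s Hs. apply H. lra.
      + intros s Hs. destruct (Hosc s) as [Ho _]; [lra|].
        destruct (Hr s ltac:(lra) (eps / 3)) as [k [Hk Hk']]; [lra|].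
        exists k. split; trivial. intros h Hh. destruct (Hk' h Hh). nra.
    - apply increment_le; trivial.
      + intros s Hs. apply H. lra.
      + intros s Hs. destruct (Hosc s) as [_ Ho]; [lra|].
        destruct (Hr s ltac:(lra) (eps / 3)) as [k [Hk Hk']]; [lra|].
        exists k. split; trivial. intros h Hh. destruct (Hk' h Hh). nra. }
  exists (mkposreal r Hr0). intros h Hh0 Hh. cbn in Hh.
  apply Rabs_def2 in Hh.
  (* The case [h < 0] uses the increment from [t + h] to [t]: this is where one-sided information
     becomes two-sided. *)
  assert (Hq : forall q, q * h = g (t + h) - g t ->
     g' t - 2 * eps / 3 <= q <= g' t + 2 * eps / 3).
  { intros q Hq. destruct (Rtotal_order h 0) as [Hneg|[?|Hpos]]; [|lra|].
    - destruct (Hinc (t + h) t); try lra. split; nra.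
    - destruct (Hinc t (t + h)); try lra. split; nra. }
  specialize (Hq ((g (t + h) - g t) / h)).
  apply Rabs_def1; destruct Hq; try (field; trivial); lra.
Qed.

Lemma definable_scaled_deriv_bounded M g (hg : definable_fun1 M g) g'
  (hg' : definable_fun1 M g') B :
  right_germ 0 (fun t => derivable_pt_lim g t (g' t)) ->
  right_germ 0 (fun t => - B <= g t <= B) ->
  exists C, right_germ 0 (fun t => - C <= t * g' t <= C).
Proof.
  (* An increment of at most [2 * B] over a length [t / 2] forces [t * |g' c| <= 4 * B] at the mean
     value point. *)
  intros Hd HB. set (K := 4 * B + 1). exists K.
  (* Otherwise [|g'| > K / t], so [g] varies by more than [2 B] between [t / 2] and [t]. *)
  assert (Hkey : forall P, right_germ 0 P -> exists t c, 0 < c /\ t / 2 < c < t /\ P c /\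
     g t - g (t / 2) = g' c * (t / 2) /\ - B <= g t <= B /\ - B <= g (t / 2) <= B).
  { intros P HP. destruct (right_germ_and _ _ _ HP (right_germ_and _ _ _ Hd HB)) as [d [Hd0 H]].
    exists (d / 2).
    destruct (MVT_cor2 g g' (d / 2 / 2) (d / 2)) as [c [E Hc]]; [lra| |].
    - intros c Hc. apply H. lra.
    - exists c. repeat split; try lra; try (apply H; lra). }
  assert (H1 : right_germ 0 (fun t => ~ K < t * g' t)).
  { destruct (definable_pred_germ M (fun t => K < t * g' t) 0) as [H|H]; trivial.
    - apply (definable_pred_sat M (FLt (TConst K) (TMul (TVar 0) (TFun g' hg' (TVar 0))))).
      reflexivity.
    - exfalso. destruct (Hkey _ H) as [t [c [Hc0 [Hc [Hk [E [B1 B2]]]]]]].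
      assert (0 <= B) by lra. assert (0 < g' c) by (unfold K in *; nra).
      assert (K < t * g' c) by nra. unfold K in *. lra. }
  assert (H2 : right_germ 0 (fun t => ~ t * g' t < - K)).
  { destruct (definable_pred_germ M (fun t => t * g' t < - K) 0) as [H|H]; trivial.
    - apply (definable_pred_sat M (FLt (TMul (TVar 0) (TFun g' hg' (TVar 0))) (TConst (- K)))).
      reflexivity.
    - exfalso. destruct (Hkey _ H) as [t [c [Hc0 [Hc [Hk [E [B1 B2]]]]]]].
      assert (0 <= B) by lra. assert (g' c < 0) by (unfold K in *; nra).
      assert (t * g' c < - K) by nra. unfold K in *. lra. }
  eapply right_germ_impl; [|apply (right_germ_and _ _ _ H1 H2)]. cbn. intros; lra.
Qed.

(** * Functions of class [C^p], possibly flat at the origin *)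

(* [Ck b p P f]: [f] is of class [C^p] at the points of [P], with vanishing
   derivatives of order [0, ..., p] at the origin if [b = true]. *)
Fixpoint Ck (b : bool) (p : nat) (P : R -> Prop) (f : R -> R) : Prop :=
  (b = true -> f 0 = 0) /\
  match p with
  | 0%nat => forall x, P x -> continuity_pt f x
  | S q => exists f', (forall x, P x -> derivable_pt_lim f x (f' x)) /\ Ck b q P f'
  end.

Lemma Ck_zero b p P f : Ck b p P f -> b = true -> f 0 = 0.
Proof. destruct p; intros [H _]; exact H. Qed.

Lemma derivable_pt_lim_continuous f x l : derivable_pt_lim f x l -> continuity_pt f x.
Proof. intros H. apply derivable_continuous_pt. now exists l. Qed.

Lemma Ck_pred b p : forall P f, Ck b (S p) P f -> Ck b p P f.
Proof.
  induction p as [|p IH]; intros P f [H0 [f' [Hf' H]]]; split; trivial.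
  - intros x Hx. eapply derivable_pt_lim_continuous; eauto.
  - exists f'. split; trivial. now apply IH.
Qed.

Lemma Ck_continuous b p P f x : Ck b p P f -> P x -> continuity_pt f x.
Proof.
  destruct p; intros [_ H] Hx; [auto|].
  destruct H as [f' [Hf' _]]. eapply derivable_pt_lim_continuous; eauto.
Qed.

Lemma Ck_plus b p : forall P f g, Ck b p P f -> Ck b p P g -> Ck b p P (fun x => f x + g x).
Proof.
  induction p as [|p IH]; intros P f g [Hf0 Hf] [Hg0 Hg]; split;
    try (intros Hb; rewrite Hf0, Hg0 by exact Hb; lra).
  - intros x Hx. apply (continuity_pt_plus f g); auto.
  - destruct Hf as [f' [Hf Hf']], Hg as [g' [Hg Hg']].
    exists (fun x => f' x + g' x). split; [|now apply IH].
    intros x Hx. apply (derivable_pt_lim_plus f g); auto.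
Qed.

(** One flat factor suffices, since each term of the Leibniz rule keeps [f] or a derivative of
    it. *)
Lemma Ck_mult b p : forall P f g,
  Ck b p P f -> Ck false p P g -> Ck b p P (fun x => f x * g x).
Proof.
  induction p as [|p IH]; intros P f g Hf Hg;
    (split; [intros Hb; rewrite (Ck_zero _ _ _ _ Hf Hb); lra|]).
  - destruct Hf as [_ Hf], Hg as [_ Hg].
    intros x Hx. apply (continuity_pt_mult f g); auto.
  - pose proof (Ck_pred _ _ _ _ Hf) as Lf. pose proof (Ck_pred _ _ _ _ Hg) as Lg.
    destruct Hf as [_ [f' [Hf Hf']]], Hg as [_ [g' [Hg Hg']]].
    exists (fun x => f' x * g x + f x * g' x). split.
    + intros x Hx. apply (derivable_pt_lim_mult f g); auto.
    + apply Ck_plus; apply IH; trivial.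
Qed.

(** A function smooth only on [P] becomes smooth on the line after an inner map into [P]; fixing the
    origin preserves flatness. *)
Lemma Ck_comp b p : forall (P : R -> Prop) f g,
  Ck b p P f -> Ck false p (fun _ => True) g -> (forall x, P (g x)) -> g 0 = 0 ->
  Ck b p (fun _ => True) (fun x => f (g x)).
Proof.
  induction p as [|p IH]; intros P f g Hf Hg HP Hg0;
    (split; [intros Hb; rewrite Hg0; now apply (Ck_zero _ _ _ _ Hf)|]).
  - destruct Hf as [_ Hf], Hg as [_ Hg].
    intros x Hx. apply (continuity_pt_comp g f); auto.
  - pose proof (Ck_pred _ _ _ _ Hg) as Lg.
    destruct Hf as [_ [f' [Hf Hf']]], Hg as [_ [g' [Hg Hg']]].
    exists (fun x => f' (g x) * g' x). split.
    + intros x Hx. apply (derivable_pt_lim_comp g f); auto.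
    + apply Ck_mult; trivial. now apply (IH P).
Qed.

Lemma Ck_const p P c : Ck false p P (fun _ => c).
Proof.
  revert c. induction p as [|p IH]; intros c; (split; [discriminate|]).
  - intros x _. apply continuity_pt_const. now intros a b.
  - exists (fun _ => 0). split; trivial. intros x _. apply derivable_pt_lim_const.
Qed.

Lemma Ck_id p P : Ck false p P (fun x => x).
Proof.
  destruct p as [|p]; (split; [discriminate|]).
  - intros x _. apply (derivable_pt_lim_continuous _ _ _ (derivable_pt_lim_id x)).
  - exists (fun _ => 1). split; [|apply Ck_const]. intros x _. apply derivable_pt_lim_id.
Qed.

Lemma Ck_subset b p : forall (P Q : R -> Prop) f,
  (forall x, Q x -> P x) -> Ck b p P f -> Ck b p Q f.
Proof.
  induction p as [|p IH]; intros P Q f HPQ [H0 H]; split; auto.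
  destruct H as [f' [Hf Hf']]. exists f'. split; eauto.
Qed.

Lemma Ck_derivs_intro b p : forall f, Ck b p (fun _ => True) f ->
  exists D, Ck_derivs p f D /\ (b = true -> forall k, (k <= p)%nat -> D k 0 = 0).
Proof.
  induction p as [|p IH]; intros f [H0 H].
  - exists (fun _ => f). split; [split; [reflexivity|split]|].
    + intros k Hk. lia.
    + intros x. now apply H.
    + auto.
  - destruct H as [f' [Hf Hf']]. destruct (IH f' Hf') as [D [[HD0 [HD1 HD2]] HD3]].
    exists (fun k => match k with 0%nat => f | S j => D j end).
    split; [split; [reflexivity|split]|].
    + intros [|k] Hk x; [rewrite HD0; now apply Hf|apply HD1; lia].
    + exact HD2.
    + intros Hb [|k] Hk; [auto|apply HD3; auto; lia].
Qed.

(** * The algebraic function [1 / sqrt (1 + t^2)] *)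

Definition inv_hyp (t : R) : R := / sqrt (1 + t * t).

Lemma inv_hyp_pos t : 0 < inv_hyp t.
Proof. apply Rinv_0_lt_compat, sqrt_lt_R0. nra. Qed.

Lemma inv_hyp_sq t : inv_hyp t * inv_hyp t * (1 + t * t) = 1.
Proof.
  unfold inv_hyp. assert (H : 0 < sqrt (1 + t * t)) by (apply sqrt_lt_R0; nra).
  rewrite <- (sqrt_sqrt (1 + t * t)) at 3 by nra. field. lra.
Qed.

Lemma inv_hyp_deriv t :
  derivable_pt_lim inv_hyp t (- (1) * (t * (inv_hyp t * (inv_hyp t * inv_hyp t)))).
Proof.
  assert (H : 0 < sqrt (1 + t * t)) by (apply sqrt_lt_R0; nra).
  assert (Hs : derivable_pt_lim (fun t => sqrt (1 + t * t)) t
    (/ (2 * sqrt (1 + t * t)) * (0 + (1 * t + t * 1)))).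
  { apply (derivable_pt_lim_comp (fun t => 1 + t * t) sqrt).
    - apply (derivable_pt_lim_plus (fun _ => 1) (fun t => t * t)).
      + apply derivable_pt_lim_const.
      + apply (derivable_pt_lim_mult (fun t => t) (fun t => t)); apply derivable_pt_lim_id.
    - apply derivable_pt_lim_sqrt. nra. }
  pose proof (derivable_pt_lim_div (fun _ => 1) _ t 0 _ (derivable_pt_lim_const 1 t) Hs) as Hd.
  cbn beta in Hd. specialize (Hd (Rgt_not_eq _ _ H)).
  eapply derivable_pt_lim_ext in Hd.
  2:{ intros z. unfold div_fct. unfold Rdiv. rewrite Rmult_1_l. reflexivity. }
  replace (- (1) * (t * (inv_hyp t * (inv_hyp t * inv_hyp t)))) with
    ((0 * sqrt (1 + t * t) - / (2 * sqrt (1 + t * t)) * (0 + (1 * t + t * 1)) * 1) /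
      (sqrt (1 + t * t))²); [exact Hd|].
  unfold inv_hyp, Rsqr. field. lra.
Qed.

(** With [w = inv_hyp t] the derivative is [- t w^3], a product of functions already covered by the
    induction. *)
Lemma Ck_inv_hyp p P : Ck false p P inv_hyp.
Proof.
  induction p as [|p IH]; (split; [discriminate|]).
  - intros x _. apply (derivable_pt_lim_continuous _ _ _ (inv_hyp_deriv x)).
  - exists (fun t => - (1) * (t * (inv_hyp t * (inv_hyp t * inv_hyp t)))).
    split; [intros x _; apply inv_hyp_deriv|].
    apply Ck_mult; [apply Ck_const|]. apply Ck_mult; [apply Ck_id|].
    apply Ck_mult; trivial. now apply Ck_mult.
Qed.

(** * Flat definable minorants *)

(* The Euler operator keeps the shape [t^k h(|t|)] under differentiation. *)
Lemma pow_even_deriv k (h h' : R -> R) d B : 0 < d ->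
  (forall t, 0 < t < d -> derivable_pt_lim h t (h' t)) ->
  (forall t, 0 < t < d -> - B <= h t <= B) ->
  forall t, - d < t < d ->
  derivable_pt_lim (fun t => t ^ (S (S k)) * h (Rabs t)) t
    (t ^ (S k) * (INR (S (S k)) * h (Rabs t) + Rabs t * h' (Rabs t))).
Proof.
  intros Hd Hder HB t Ht. destruct (Rtotal_order t 0) as [Hneg|[->|Hpos]].
  - apply (derivable_pt_lim_locally_ext (fun t => t ^ (S (S k)) * h (- t)) _ t (- d) 0); [lra| |].
    { intros z Hz. now rewrite Rabs_left by lra. }
    rewrite Rabs_left by lra.
    replace (t ^ (S k) * (INR (S (S k)) * h (- t) + - t * h' (- t))) with
      (INR (S (S k)) * t ^ (S k) * h (- t) + t ^ (S (S k)) * (h' (- t) * - (1)))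
      by (cbn [pow]; ring).
    apply (derivable_pt_lim_mult (fun t => t ^ (S (S k))) (fun t => h (- t))).
    + apply (derivable_pt_lim_pow t (S (S k))).
    + apply (derivable_pt_lim_comp (fun t => - t) h).
      * apply (derivable_pt_lim_opp (fun t => t)), derivable_pt_lim_id.
      * apply Hder. lra.
  (* At the origin the difference quotient is [s^(k+1) h(|s|)], bounded by [|s| B] when [|s| < 1].
     Dividing [eps] by [B + 1] also covers [B = 0]. *)
  - replace (0 ^ (S k) * _) with 0 by (cbn [pow]; ring).
    intros eps Heps.
    assert (HB0 : 0 <= B) by (specialize (HB (d / 2) ltac:(lra)); lra).
    assert (Hr : 0 < Rmin (Rmin d 1) (eps / (B + 1))).
    { repeat apply Rmin_pos; try lra. apply Rdiv_lt_0_compat; lra. }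
    exists (mkposreal _ Hr). cbn [pos]. intros s Hs0 Hs.
    rewrite Rplus_0_l. unfold Rminus at 1 2.
    replace ((s ^ S (S k) * h (Rabs s) + - (0 ^ S (S k) * h (Rabs 0))) / s + - 0)
      with (s ^ S k * h (Rabs s)) by (cbn [pow]; field; trivial).
    assert (Hs1 : Rabs s < d /\ Rabs s < 1 /\ Rabs s < eps / (B + 1)).
    { pose proof (Rmin_l (Rmin d 1) (eps / (B + 1))). pose proof (Rmin_r (Rmin d 1) (eps / (B + 1))).
      pose proof (Rmin_l d 1). pose proof (Rmin_r d 1). lra. }
    pose proof (Rabs_pos_lt s Hs0) as Hsp.
    rewrite Rabs_mult, <- RPow_abs. cbn [pow].
    assert (Hp : 0 <= Rabs s ^ k <= 1).
    { split; [apply pow_le; lra|]. rewrite <- (pow1 k). apply pow_incr. lra. }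
    assert (Hh : 0 <= Rabs (h (Rabs s)) <= B).
    { split; [apply Rabs_pos|]. apply Rabs_le. apply HB. lra. }
    assert (He : Rabs s * (B + 1) < eps).
    { replace eps with (eps / (B + 1) * (B + 1)) by (field; lra).
      apply Rmult_lt_compat_r; lra. }
    assert (Rabs s * Rabs s ^ k * Rabs (h (Rabs s)) <= Rabs s * B); [|nra].
    apply Rmult_le_compat; try nra.
  - apply (derivable_pt_lim_locally_ext (fun t => t ^ (S (S k)) * h t) _ t 0 d); [lra| |].
    { intros z Hz. now rewrite Rabs_right by lra. }
    rewrite Rabs_right by lra.
    replace (t ^ (S k) * (INR (S (S k)) * h t + t * h' t)) with
      (INR (S (S k)) * t ^ (S k) * h t + t ^ (S (S k)) * h' t) by (cbn [pow]; ring).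
    apply (derivable_pt_lim_mult (fun t => t ^ (S (S k))) h).
    + apply (derivable_pt_lim_pow t (S (S k))).
    + apply Hder. lra.
Qed.

(** Each derivative spends one power of [t] and replaces [h] by the bounded definable [k h + t h'].
    The parameter [q] leaves powers to spare, so that the exponent can later be made odd. *)
Lemma flat_pow_even M q p : forall h B, definable_fun1 M h ->
  right_germ 0 (fun t => - B <= h t <= B) ->
  exists e, 0 < e /\
    Ck true p (fun t => - e < t < e) (fun t => t ^ (S (S (p + q))) * h (Rabs t)).
Proof.
  induction p as [|p IH]; intros h B hh HB;
    destruct (definable_derivable M h hh) as [h' [hh' Hd]].
  - destruct (right_germ_and _ _ _ HB Hd) as [d [Hd0 H]].
    exists d. split; trivial. split; [intros _; cbn; ring|].
    intros x Hx. eapply derivable_pt_lim_continuous.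
    apply (pow_even_deriv (0 + q) h h' d B); trivial; intros t Ht; apply H; lra.
  - destruct (definable_scaled_deriv_bounded M h hh h' hh' B Hd HB) as [C HC].
    set (k := INR (S (S (S p + q)))).
    destruct (IH (fun t => k * h t + t * h' t) (k * B + C)) as [e [He HCk]].
    { apply (definable_fun1_teval M (TAdd (TMul (TConst k) (TFun h hh (TVar 0)))
        (TMul (TVar 0) (TFun h' hh' (TVar 0))))). }
    { eapply right_germ_impl; [|apply (right_germ_and _ _ _ HB HC)].
      cbn beta. intros t _ [H1 H2].
      assert (0 <= k) by apply pos_INR. nra. }
    destruct (right_germ_and _ _ _ HB Hd) as [d [Hd0 H]].
    exists (Rmin d e). split; [now apply Rmin_pos|].
    pose proof (Rmin_l d e). pose proof (Rmin_r d e).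
    split; [intros _; cbn [pow Nat.add]; ring|].
    exists (fun t => t ^ (S (S (p + q))) * (k * h (Rabs t) + Rabs t * h' (Rabs t))). split.
    + intros x Hx. apply (pow_even_deriv (S p + q) h h' d B); trivial;
        try (intros t Ht; apply H); lra.
    + eapply Ck_subset; [|exact HCk]. cbn. intros; lra.
Qed.

(** * From a germ at the origin to a bijection of the line *)

Lemma definable_fun1_abs M : definable_fun1 M Rabs.
Proof.
  apply (definable_fun1_sat M (FOr (FAnd (FLt (TVar 0) (TConst 0)) (FEq (TVar 1) (TSub (TConst 0) (TVar 0))))
    (FAnd (FNot (FLt (TVar 0) (TConst 0))) (FEq (TVar 1) (TVar 0))))).
  intros t y. cbn. unfold Rabs. destruct (Rcase_abs t); split; intros; lra.
Qed.

Lemma definable_fun1_inv_hyp M : definable_fun1 M inv_hyp.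
Proof.
  apply (definable_fun1_sat M (FAnd (FLt (TConst 0) (TVar 1))
    (FEq (TMul (TMul (TVar 1) (TVar 1)) (TAdd (TConst 1) (TMul (TVar 0) (TVar 0)))) (TConst 1)))).
  intros t y. cbn. split.
  - intros [Hy E]. pose proof (inv_hyp_pos t). pose proof (inv_hyp_sq t).
    apply Rsqr_inj; [lra|lra|]. unfold Rsqr.
    apply (Rmult_eq_reg_r (1 + t * t)); nra.
  - intros ->. split; [apply inv_hyp_pos|apply inv_hyp_sq].
Qed.

Fixpoint TPow {M} (t : term M) (n : nat) : term M :=
  match n with 0%nat => TConst 1 | S n => TMul t (TPow t n) end.

Lemma teval_TPow M (t : term M) n x : teval (TPow t n) x = teval t x ^ n.
Proof. induction n as [|n IH]; cbn; [|rewrite IH]; reflexivity. Qed.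

(** For [d > 0] an odd increasing algebraic map of the line into [(-d, d)], used to globalize a
    germ. *)
Definition squash (d t : R) : R := d * (t * inv_hyp t).

Lemma squash_opp d t : squash d (- t) = - squash d t.
Proof.
  unfold squash, inv_hyp. replace (- t * - t) with (t * t) by ring. ring.
Qed.

Lemma squash_incr d s t : 0 < d -> 0 <= s -> s < t -> squash d s < squash d t.
Proof.
  intros Hd Hs Hst. unfold squash. apply Rmult_lt_compat_l; trivial.
  pose proof (inv_hyp_pos s). pose proof (inv_hyp_pos t).
  pose proof (inv_hyp_sq s) as Es. pose proof (inv_hyp_sq t) as Et.
  apply Rsqr_incrst_0; [|nra|nra]. unfold Rsqr.
  (* By [inv_hyp_sq], [t^2 w(t)^2 = 1 - w(t)^2] with [w = inv_hyp], so comparing the squares amounts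
     to [w^2] decreasing. *)
  assert (inv_hyp t * inv_hyp t < inv_hyp s * inv_hyp s); [|nra].
  apply (Rmult_lt_reg_r ((1 + s * s) * (1 + t * t))); [nra|].
  replace (inv_hyp t * inv_hyp t * ((1 + s * s) * (1 + t * t))) with
    (inv_hyp t * inv_hyp t * (1 + t * t) * (1 + s * s)) by ring.
  replace (inv_hyp s * inv_hyp s * ((1 + s * s) * (1 + t * t))) with
    (inv_hyp s * inv_hyp s * (1 + s * s) * (1 + t * t)) by ring.
  rewrite Es, Et. nra.
Qed.

Lemma squash_bound d t : 0 < d -> - d < squash d t < d.
Proof.
  intros Hd. pose proof (inv_hyp_pos t). pose proof (inv_hyp_sq t) as Et.
  assert (- (1) < t * inv_hyp t < 1) by (split; nra).
  unfold squash. nra.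
Qed.

Lemma squash_le d t : 0 < d <= 1 -> 0 <= t -> 0 <= squash d t <= t.
Proof.
  intros Hd Ht. pose proof (inv_hyp_pos t). pose proof (inv_hyp_sq t) as Et.
  assert (inv_hyp t <= 1) by nra. unfold squash.
  assert (0 <= t * inv_hyp t <= t) by nra. nra.
Qed.

Lemma flat_minorant M (mu : R -> R) (hmu : definable_fun1 M mu) p :
  (forall t, 0 <= mu t <= 1) -> (forall t, 0 < t -> 0 < mu t) ->
  (forall s t, s <= t -> mu s <= mu t) ->
  exists phi : R -> R,
    (forall t, phi (- t) = - phi t) /\
    (forall s t, s < t -> phi s < phi t) /\
    (forall y, exists t, phi t = y) /\
    definable_fun1 M phi /\ of_class_C p phi /\ p_flat_at_zero p phi /\
    forall t, 0 <= t < / 2 -> phi t <= mu t.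
Proof.
  intros Hmu Hpos Hmono.
  (* Thus [N = 2 p + 3]: odd, which makes [psi] odd, and of the form required by [flat_pow_even]
     with [q = p + 1]. *)
  set (N := S (S (p + S p))).
  destruct (flat_pow_even M (S p) p mu 1 hmu) as [e [He HCk]].
  { apply right_germ_all. intros t _. specialize (Hmu t). lra. }
  fold N in HCk.
  set (psi := fun t => t ^ N * mu (Rabs t)) in *.
  assert (HN : N = (2 * S p + 1)%nat) by (unfold N; lia).
  assert (psi_opp : forall t, psi (- t) = - psi t).
  { intros t. unfold psi. rewrite Rabs_Ropp.
    replace (- t) with (-1 * t) by ring. rewrite Rpow_mult_distr.
    replace ((-1) ^ N) with (-1); [ring|]. rewrite HN, Nat.add_1_r. symmetry. apply pow_1_odd. }
  assert (psi_pos : forall t, 0 < t -> 0 < psi t).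
  { intros t Ht. unfold psi. rewrite Rabs_right by lra.
    apply Rmult_lt_0_compat; [now apply pow_lt|now apply Hpos]. }
  assert (psi_0 : psi 0 = 0) by (unfold psi, N; cbn [pow]; ring).
  assert (psi_incr : forall s t, 0 <= s -> s < t -> psi s < psi t).
  { intros s t [Hs| <-] Hst; [|rewrite psi_0; now apply psi_pos].
    unfold psi. rewrite !Rabs_right by lra.
    apply Rlt_le_trans with (t ^ N * mu s).
    - apply Rmult_lt_compat_r; [now apply Hpos|].
      assert (Hp : s ^ (p + S p) <= t ^ (p + S p)) by (apply pow_incr; lra).
      assert (Hp0 : 0 < s ^ (p + S p)) by now apply pow_lt.
      unfold N. cbn [pow]. assert (s * s < t * t) by nra. nra.
    - apply Rmult_le_compat_l; [apply pow_le; lra|apply Hmono; lra]. }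
  (* The bound [d <= e] keeps [squash d] where [psi] is known to be smooth, and [d <= 1] gives
     [squash d t <= t] for [t >= 0]. *)
  set (d := Rmin e 1).
  assert (Hd : 0 < d) by (apply Rmin_pos; lra).
  assert (Hd1 : d <= 1) by apply Rmin_r. assert (Hde : d <= e) by apply Rmin_l.
  (* Since [squash d] takes values in [(-d, d)], [psi (squash d t)] stays bounded; the factor
     [1 + t^2] restores surjectivity. *)
  set (phi := fun t => psi (squash d t) * (1 + t * t)).
  assert (squash_0 : squash d 0 = 0) by (unfold squash; ring).
  assert (phi_opp : forall t, phi (- t) = - phi t).
  { intros t. unfold phi. rewrite squash_opp, psi_opp. ring. }
  assert (phi_0 : phi 0 = 0) by (unfold phi; rewrite squash_0, psi_0; ring).
  assert (phi_incr0 : forall s t, 0 <= s -> s < t -> phi s < phi t).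
  { intros s t Hs Hst. unfold phi.
    pose proof (squash_le d s (conj Hd Hd1) Hs) as Hq.
    pose proof (psi_incr _ _ (proj1 Hq) (squash_incr d s t Hd Hs Hst)) as Hlt.
    assert (0 <= psi (squash d s)).
    { destruct (Rle_lt_or_eq_dec _ _ (proj1 Hq)) as [H|<-]; [left; auto|lra]. }
    assert (s * s <= t * t) by nra. nra. }
  assert (phi_incr : forall s t, s < t -> phi s < phi t).
  { intros s t Hst. destruct (Rle_lt_dec 0 s) as [Hs|Hs]; [now apply phi_incr0|].
    rewrite <- (Ropp_involutive s), phi_opp.
    assert (H : 0 < phi (- s)) by (rewrite <- phi_0; apply phi_incr0; lra).
    destruct (Rle_lt_dec 0 t) as [[Ht| <-]|Ht].
    - assert (0 < phi t) by (rewrite <- phi_0; apply phi_incr0; lra). lra.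
    - lra.
    - rewrite <- (Ropp_involutive t), (phi_opp (- t)).
      assert (phi (- t) < phi (- s)) by (apply phi_incr0; lra). lra. }
  assert (phi_Ck : Ck true p (fun _ => True) phi).
  { assert (Hid : Ck false p (fun _ => True) (fun x => x)) by apply Ck_id.
    apply (Ck_mult true p _ (fun t => psi (squash d t)) (fun t => 1 + t * t)).
    - apply (Ck_comp true p (fun t => - e < t < e)); trivial.
      + unfold squash. apply Ck_mult; [apply Ck_const|]. apply Ck_mult; [apply Hid|].
        apply Ck_inv_hyp.
      + intros x. pose proof (squash_bound d x Hd). lra.
    - apply Ck_plus; [apply Ck_const|]. now apply Ck_mult. }
  assert (phi_cont : continuity phi).
  { intros x. now apply (Ck_continuous _ _ _ _ _ phi_Ck). }
  exists phi. split; [exact phi_opp|]. split; [exact phi_incr|]. repeat split.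
  - assert (Hp : forall y, 0 < y -> exists t, phi t = y).
    { intros y Hy.
      assert (Hc : 0 < psi (squash d 1)).
      { rewrite <- psi_0 at 1. apply psi_incr; [lra|].
        rewrite <- squash_0. apply squash_incr; lra. }
      set (c := psi (squash d 1)) in *.
      assert (Hyc : 0 < y / c) by now apply Rdiv_lt_0_compat.
      (* As [T >= 1], monotonicity gives [phi T >= c (1 + T^2) > c (1 + y / c) = c + y]. *)
      set (T := 1 + y / c).
      assert (HT : y < phi T).
      { assert (c < psi (squash d T)).
        { unfold c. apply psi_incr; [apply squash_le; lra|].
          apply squash_incr; unfold T; lra. }
        assert (E : c * (y / c) = y) by (field; lra).
        assert (1 + y / c < 1 + T * T) by (unfold T; nra).
        unfold phi. apply Rlt_trans with (c * (1 + T * T)); [nra|].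
        apply Rmult_lt_compat_r; trivial. unfold T. nra. }
      destruct (IVT (fun t => phi t - y) 0 T) as [z [_ Hz]].
      - intros x. apply (continuity_pt_minus phi (fun _ => y)); [apply phi_cont|].
        apply continuity_pt_const. now intros a b.
      - unfold T; lra.
      - rewrite phi_0. lra.
      - lra.
      - exists z. lra. }
    intros y. destruct (Rtotal_order y 0) as [H|[->|H]]; auto.
    + destruct (Hp (- y)) as [t Ht]; [lra|]. exists (- t). rewrite phi_opp. lra.
    + now exists 0.
  - set (T := TMul (TConst d) (TMul (TVar 0) (TFun inv_hyp (definable_fun1_inv_hyp M) (TVar 0)))).
    replace phi with (fun t => teval (TMul
      (TMul (TPow T N) (TFun mu hmu (TFun Rabs (definable_fun1_abs M) T)))
      (TAdd (TConst 1) (TMul (TVar 0) (TVar 0)))) [t]); [apply definable_fun1_teval|].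
    extensionality t. cbn [teval]. rewrite teval_TPow. reflexivity.
  - destruct (Ck_derivs_intro true p phi phi_Ck) as [D [HD _]]. now exists D.
  - destruct (Ck_derivs_intro true p phi phi_Ck) as [D [HD HD0]]. exists D. split; auto.
  - intros t Ht. unfold phi, psi.
    destruct (squash_le d t (conj Hd Hd1) (proj1 Ht)) as [Hq0 Hq1].
    rewrite Rabs_right by lra.
    (* This factor [/ 2] absorbs [1 + t^2 <= 2], which is why the comparison is made for
       [t < / 2]. *)
    assert (H1 : squash d t ^ N <= / 2).
    { apply Rle_trans with (t ^ N); [apply pow_incr; lra|].
      unfold N. cbn [pow].
      assert (0 <= t ^ (p + S p) <= 1); [|nra].
      split; [apply pow_le; lra|]. rewrite <- (pow1 (p + S p)). apply pow_incr. lra. }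
    assert (H0 : 0 <= squash d t ^ N) by now apply pow_le.
    assert (H2 : mu (squash d t) <= mu t) by now apply Hmono.
    pose proof (Hmu (squash d t)). pose proof (Hmu t).
    assert (1 + t * t <= 2) by nra.
    assert (squash d t ^ N * mu (squash d t) <= / 2 * mu t) by (apply Rmult_le_compat; lra).
    nra.
Qed.

(** * Norms, distances and cluster points *)

Definition sumsq (l : list R) : R := fold_right (fun a s => a * a + s) 0 l.

Lemma sumsq_nonneg l : 0 <= sumsq l.
Proof. induction l as [|a l IH]; cbn; [lra|]. fold (sumsq l). nra. Qed.

Lemma enorm_nonneg l : 0 <= enorm l.
Proof. apply sqrt_pos. Qed.

Lemma sqrt_plus_le a b : 0 <= a -> 0 <= b -> sqrt (a + b) <= sqrt a + sqrt b.
Proof.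
  intros Ha Hb. pose proof (sqrt_pos a). pose proof (sqrt_pos b).
  apply Rsqr_incr_0_var; [|lra]. rewrite Rsqr_sqrt by lra. unfold Rsqr.
  pose proof (sqrt_sqrt a Ha). pose proof (sqrt_sqrt b Hb). nra.
Qed.

Lemma enorm_app l l' : enorm (l ++ l') <= enorm l + enorm l'.
Proof.
  assert (E : sumsq (l ++ l') = sumsq l + sumsq l').
  { unfold sumsq. induction l as [|a l IH]; cbn [app fold_right]; [|rewrite IH]; ring. }
  change (sqrt (sumsq (l ++ l')) <= sqrt (sumsq l) + sqrt (sumsq l')).
  rewrite E. apply sqrt_plus_le; apply sumsq_nonneg.
Qed.

Lemma enorm_cons_ge a l : Rabs a <= enorm (a :: l) /\ enorm l <= enorm (a :: l).
Proof.
  change (enorm l) with (sqrt (sumsq l)).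
  change (enorm (a :: l)) with (sqrt (a * a + sumsq l)).
  pose proof (sumsq_nonneg l). split.
  - rewrite <- sqrt_Rsqr_abs. apply sqrt_le_1_alt. unfold Rsqr. lra.
  - apply sqrt_le_1_alt. nra.
Qed.

Lemma enorm_cons_le a l : enorm (a :: l) <= Rabs a + enorm l.
Proof.
  apply (Rle_trans _ _ _ (enorm_app [a] l)). apply Rplus_le_compat_r.
  unfold enorm. cbn. rewrite Rplus_0_r. apply Req_le. apply sqrt_Rsqr_abs.
Qed.

Lemma edist_nonneg x y : 0 <= edist x y.
Proof. apply enorm_nonneg. Qed.

Lemma edist_sym x y : edist x y = edist y x.
Proof.
  unfold edist, enorm. f_equal. revert y.
  induction x as [|a x IH]; intros [|b y]; cbn; trivial. rewrite IH. ring.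
Qed.

Lemma edist_app x x' y y' : length x = length x' ->
  edist (x ++ y) (x' ++ y') <= edist x x' + edist y y'.
Proof.
  intros H. unfold edist.
  replace (combine (x ++ y) (x' ++ y')) with (combine x x' ++ combine y y').
  - rewrite map_app. apply enorm_app.
  - revert x' H. induction x as [|a x IH]; intros [|a' x'] H; try discriminate; cbn; trivial.
    f_equal. apply IH. now injection H.
Qed.

Lemma edist_origin n y : length y = n -> edist (repeat 0 n) y = enorm y.
Proof.
  intros <-. unfold edist, enorm. f_equal.
  induction y as [|a y IH]; cbn; trivial. rewrite IH. ring.
Qed.

Lemma edist_coord x : forall a r, length x = length a -> edist x a <= r ->
  Forall2 (fun u v => Rabs (u - v) <= r) x a.
Proof.
  induction x as [|u x IH]; intros [|v a] r Hl Hr; try discriminate; constructor;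
    destruct (enorm_cons_ge (u - v) (map (fun p => fst p - snd p) (combine x a)));
    unfold edist in Hr; cbn [combine map fst snd] in Hr.
  - lra.
  - apply IH; [now injection Hl|]. unfold edist. lra.
Qed.

Lemma edist_le_sum x c eta : Forall2 (fun u v => Rabs (u - v) < eta) x c ->
  edist x c <= INR (length c) * eta.
Proof.
  induction 1 as [|u v x c Huv H IH].
  - unfold edist, enorm. cbn. rewrite sqrt_0. lra.
  - cbn [length]. rewrite S_INR.
    apply (Rle_trans _ _ _ (enorm_cons_le (u - v) (map (fun p => fst p - snd p) (combine x c)))).
    fold (edist x c). lra.
Qed.

(** Bolzano-Weierstrass for nonempty sets [A e] shrinking with [e] inside a cube. Working with a
    family instead of a sequence avoids extracting subsequences coordinate by coordinate. *)
Lemma cluster_point (a : list R) : forall A : R -> list R -> Prop,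
  (forall e, 0 < e -> exists x, A e x) ->
  (forall e e' x, e <= e' -> A e x -> A e' x) ->
  (forall e x, A e x -> Forall2 (fun u v => Rabs (u - v) <= 1) x a) ->
  exists c, length c = length a /\ forall eta, 0 < eta ->
    exists x, A eta x /\ Forall2 (fun u v => Rabs (u - v) < eta) x c.
Proof.
  induction a as [|a0 a IH]; intros A Hne Hmono Hbd.
  - exists []. split; trivial. intros eta Heta. destruct (Hne eta Heta) as [x Hx].
    exists x. split; trivial. apply Hbd in Hx. inversion Hx. constructor.
  - (* The first coordinate of [c] is the limit superior of the first coordinates. *)
    assert (Hhd : forall e x, A e x -> exists u y, x = u :: y /\ a0 - 1 <= u <= a0 + 1 /\
       Forall2 (fun u v => Rabs (u - v) <= 1) y a).
    { intros e x Hx. apply Hbd in Hx. inversion Hx as [|u v y w Huv Hy]; subst.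
      exists u, y. repeat split; trivial;
        unfold Rabs in Huv; destruct (Rcase_abs _) in Huv; lra. }
    destruct (completeness (fun s => forall e, 0 < e -> exists u y, A e (u :: y) /\ s <= u))
      as [c0 [Hub Hlub]].
    { exists (a0 + 1). intros s Hs. destruct (Hs 1) as [u [y [H1 H2]]]; [lra|].
      destruct (Hhd _ _ H1) as [u' [y' [E [H3 _]]]]. injection E as <- <-. lra. }
    { exists (a0 - 1). intros e He. destruct (Hne e He) as [x Hx].
      destruct (Hhd _ _ Hx) as [u [y [-> [H3 _]]]]. exists u, y. split; trivial. lra. }
    (* The tails of points of [A e] whose head is within [e] of [c0] form a family of the same
       kind. *)
    destruct (IH (fun e y => exists u, A e (u :: y) /\ Rabs (u - c0) < e)) as [c [Hc HcA]].
    + intros e He.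
      assert (H1 : exists s, (forall e, 0 < e -> exists u y, A e (u :: y) /\ s <= u) /\ c0 - e < s).
      { apply NNPP. intros Hn. assert (c0 <= c0 - e); [|lra]. apply Hlub.
        intros s Hs. apply Rnot_lt_le. intros Hlt. apply Hn. eauto. }
      destruct H1 as [s [Hs Hse]].
      assert (H2 : exists e0, 0 < e0 /\ forall u y, A e0 (u :: y) -> u < c0 + e).
      { apply NNPP. intros Hn. assert (c0 + e <= c0); [|lra]. apply Hub.
        intros e0 He0. apply NNPP. intros Hn'. apply Hn. exists e0. split; trivial.
        intros u y Hu. apply Rnot_le_lt. intros Hle. apply Hn'. eauto. }
      destruct H2 as [e0 [He0 H2]].
      destruct (Hs (Rmin e e0)) as [u [y [Hu Hsu]]]; [now apply Rmin_pos|].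
      exists y, u. split.
      * apply (Hmono (Rmin e e0)); trivial. apply Rmin_l.
      * assert (u < c0 + e).
        { apply (H2 u y). apply (Hmono (Rmin e e0)); trivial. apply Rmin_r. }
        apply Rabs_def1; lra.
    + intros e e' y Hee [u [Hu Hc]]. exists u. split; [eauto|lra].
    + intros e y [u [Hu _]]. destruct (Hhd _ _ Hu) as [u' [y' [E [_ H]]]].
      now injection E as <- <-.
    + exists (c0 :: c). split; [cbn; now rewrite Hc|].
      intros eta Heta. destruct (HcA eta Heta) as [y [[u [Hu Huc]] Hy]].
      exists (u :: y). split; trivial. now constructor.
Qed.

Lemma glb_exists (E : R -> Prop) b :
  (exists y, E y) -> (forall y, E y -> b <= y) -> exists l, is_glb E l.
Proof.
  intros [y0 Hy0] Hb.
  destruct (completeness (fun y => E (- y))) as [l [Hub Hlub]].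
  - exists (- b). intros y Hy. apply Hb in Hy. lra.
  - exists (- y0). now rewrite Ropp_involutive.
  - exists (- l). split.
    + intros y Hy. assert (- y <= l); [|lra]. apply Hub. now rewrite Ropp_involutive.
    + intros l' Hl'. assert (l <= - l'); [|lra]. apply Hlub. intros y Hy. apply Hl' in Hy. lra.
Qed.

Lemma glb_unique E l l' : is_glb E l -> is_glb E l' -> l = l'.
Proof. intros [H1 H2] [H1' H2']. apply Rle_antisym; auto. Qed.

(** * Definability of the comparison function *)

Fixpoint FExs {M} (k : nat) (F : form M) : form M :=
  match k with 0%nat => F | S k => FEx (FExs k F) end.

Lemma sat_FExs M k (F : form M) : forall x,
  sat (FExs k F) x <-> exists y, length y = k /\ sat F (x ++ y).
Proof.
  induction k as [|k IH]; intros x; cbn.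
  - split.
    + intros H. exists []. now rewrite app_nil_r.
    + intros [[|] [Hy H]]; [now rewrite app_nil_r in H|discriminate].
  - setoid_rewrite IH. split.
    + intros [t [y [Hy H]]]. exists (t :: y). rewrite <- app_assoc in H. cbn in *. auto.
    + intros [[|t y] [Hy H]]; [discriminate|]. exists t, y. rewrite <- app_assoc. cbn in *. auto.
Qed.

Lemma definable_fun1_sqrt M : definable_fun1 M sqrt.
Proof.
  apply (definable_fun1_sat M (FOr
    (FAnd (FNot (FLt (TVar 0) (TConst 0))) (FAnd (FNot (FLt (TVar 1) (TConst 0)))
       (FEq (TMul (TVar 1) (TVar 1)) (TVar 0))))
    (FAnd (FLt (TVar 0) (TConst 0)) (FEq (TVar 1) (TConst 0))))).
  intros t y. cbn. split.
  - intros [[Ht [Hy E]]|[Ht ->]].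
    + rewrite <- E. symmetry. apply sqrt_square. lra.
    + symmetry. apply sqrt_neg_0. lra.
  - intros ->. destruct (Rlt_le_dec t 0) as [H|H].
    + right. split; trivial. apply sqrt_neg_0. lra.
    + left. split; [lra|]. split; [pose proof (sqrt_pos t); lra|now apply sqrt_sqrt].
Qed.

Definition TNorm {M} (l : list (term M)) : term M :=
  TFun sqrt (definable_fun1_sqrt M) (fold_right (fun t s => TAdd (TMul t t) s) (TConst 0) l).

Definition TDist {M} (l l' : list (term M)) : term M :=
  TNorm (map (fun p => TSub (fst p) (snd p)) (combine l l')).

Lemma teval_TNorm M (l : list (term M)) x :
  teval (TNorm l) x = enorm (map (fun t => teval t x) l).
Proof.
  unfold enorm. cbn. f_equal. induction l as [|t l IH]; cbn; trivial. now rewrite IH.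
Qed.

Lemma teval_TDist M (l l' : list (term M)) x :
  teval (TDist l l') x = edist (map (fun t => teval t x) l) (map (fun t => teval t x) l').
Proof.
  unfold TDist, edist. rewrite teval_TNorm. f_equal. revert l'.
  induction l as [|t l IH]; intros [|t' l']; cbn; trivial. now rewrite IH.
Qed.

Definition TVars {M} (i k : nat) : list (term M) := map TVar (seq i k).

Lemma map_teval_TVars M i k x :
  map (fun t : term M => teval t x) (TVars i k) = select (seq i k) x.
Proof. unfold TVars. now rewrite map_map. Qed.

Lemma map_teval_TConst M a x : map (fun t : term M => teval t x) (map TConst a) = a.
Proof. rewrite map_map. cbn. apply map_id. Qed.

(** [FRel] expects the arity in the form [length l]. *)
Lemma Def_seq M k (A : list R -> Prop) i : Def M k A -> Def M (length (seq i k)) A.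
Proof. now rewrite length_seq. Qed.

Lemma closure_definable M k A : Def M k A -> Def M k (closure k A).
Proof.
  intros hA. eapply Def_ext.
  (* Levels: [x] fills [0, ..., k-1], the radius is [k], and the nearby point [w] starts at
     [S k]. *)
  { apply (definable_sat M (FAll (FImp (FLt (TConst 0) (TVar k))
      (FExs k (FAnd (FRel A (seq (S k) k) (Def_seq M k A _ hA))
        (FLt (TDist (TVars 0 k) (TVars (S k) k)) (TVar k)))))) k). }
  intros x. unfold closure.
  assert (E : length x = k -> forall e w, nth k (x ++ e :: w) 0 = e).
  { intros Hx e w. rewrite <- (Nat.add_0_r k). now apply nth_app_add. }
  assert (E1 : length x = k -> forall e w, length w = k ->
     select (seq (S k) k) (x ++ e :: w) = w).
  { intros Hx e w Hw. change (e :: w) with ([e] ++ w). rewrite app_assoc.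
    apply select_block_end; trivial. rewrite length_app. cbn. lia. }
  assert (E2 : length x = k -> forall w, select (seq 0 k) (x ++ w) = x)
    by (intros; now apply select_block_start).
  cbn [sat]. setoid_rewrite sat_FExs. cbn [sat]. setoid_rewrite teval_TDist.
  setoid_rewrite map_teval_TVars. cbn [teval].
  split; intros [Hx H]; split; trivial; intros e He.
  - destruct (H e) as [w [Hw [HA Hd]]]; [now rewrite E|].
    rewrite <- app_assoc in HA, Hd. cbn [app] in HA, Hd.
    rewrite E1 in HA, Hd by trivial. rewrite E2, E in Hd by trivial. eauto.
  - rewrite E in He by trivial. destruct (H e He) as [w [HA Hd]].
    pose proof (Def_dim M k A hA w HA) as Hw.
    exists w. rewrite <- app_assoc. cbn [app]. rewrite E1, E2, E by trivial. auto.
Qed.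

Lemma gen_zero_set_definable M m n Omega f :
  Def M (m + n) (graph Omega f) -> Def M m (gen_zero_set m n Omega f).
Proof.
  intros hf. eapply Def_ext.
  { (* the out-of-range index [m] selects [0] *)
    apply (definable_select M (m + n) _ (closure_definable M _ _ hf) m (seq 0 m ++ repeat m n)).
    now rewrite length_app, length_seq, repeat_length. }
  intros x. unfold gen_zero_set.
  assert (E : length x = m -> select (seq 0 m ++ repeat m n) x = x ++ repeat 0 n).
  { intros Hx. unfold select. rewrite map_app. f_equal.
    - now apply (select_block_end []).
    - rewrite map_repeat. f_equal. apply nth_overflow. lia. }
  cbn beta. split; intros [Hx H]; split; trivial.
  - now rewrite <- E.
  - now rewrite E.
Qed.

Lemma glb_definable M (V : R -> R -> Prop) (mu : R -> R) :
  Def M 2 (fun z => exists t v, z = [t; v] /\ V t v) ->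
  (forall t, is_glb (V t) (mu t)) -> definable_fun1 M mu.
Proof.
  intros hV Hmu.
  assert (HV : forall t v, (exists t' v', [t; v] = [t'; v'] /\ V t' v') <-> V t v).
  { intros t v. split; [|eauto]. intros [t' [v' [E H]]]. now injection E as -> ->. }
  (* Level [0] is [t] and level [1] the candidate. Level [2] is a value in the first clause and a
     competing lower bound in the second, whose values are at level [3]. *)
  apply (definable_fun1_sat M (FAnd
    (FAll (FImp (FRel _ [0; 2]%nat hV) (FNot (FLt (TVar 2) (TVar 1)))))
    (FAll (FImp (FAll (FImp (FRel _ [0; 3]%nat hV) (FNot (FLt (TVar 3) (TVar 2)))))
       (FNot (FLt (TVar 1) (TVar 2))))))).
  intros t y. cbn. setoid_rewrite HV.
  assert (E : forall a b, ~ a < b <-> b <= a) by (intros; split; [apply Rnot_lt_le|apply Rle_not_lt]).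
  setoid_rewrite E. change (is_glb (V t) y <-> y = mu t). split.
  - intros H. now apply (glb_unique (V t)).
  - intros ->. apply Hmu.
Qed.

(* The value [1] keeps this set of values nonempty for large [t]. *)
Definition far_values (m n : nat) (Omega : list R -> Prop) (f : list R -> list R)
  (a : list R) (t v : R) : Prop :=
  v = 1 \/ exists x, Omega x /\ edist x a <= 1 /\ v = enorm (f x) /\
    forall z, gen_zero_set m n Omega f z -> t <= edist x z.

Lemma far_values_definable M m n Omega f a :
  (forall x, Omega x -> length x = m) ->
  (forall x, Omega x -> length (f x) = n) ->
  Def M (m + n) (graph Omega f) ->
  Def M 2 (fun z => exists t v, z = [t; v] /\ far_values m n Omega f a t v).
Proof.
  intros hO hn hf. set (Z := gen_zero_set m n Omega f).
  pose proof (gen_zero_set_definable M m n Omega f hf) as hZ. fold Z in hZ.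
  eapply Def_ext.
  (* Quantifying over the whole graph point [x ++ f x], from level [2] on, gives access to [f x]
     without a term for [f]; a zero [z] starts at level [2 + (m + n)]. *)
  { apply (definable_sat M (FOr (FEq (TVar 1) (TConst 1)) (FExs (m + n)
      (FAnd (FRel _ (seq 2 (m + n)) (Def_seq M _ _ _ hf))
      (FAnd (FNot (FLt (TConst 1) (TDist (TVars 2 m) (map TConst a))))
      (FAnd (FEq (TVar 1) (TNorm (TVars (2 + m) n)))
        (FNot (FExs m (FAnd (FRel _ (seq (2 + (m + n)) m) (Def_seq M _ _ _ hZ))
          (FLt (TDist (TVars 2 m) (TVars (2 + (m + n)) m)) (TVar 0)))))))))) 2). }
  cbn [sat]. intros z. setoid_rewrite sat_FExs. cbn [sat]. setoid_rewrite sat_FExs. cbn [sat].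
  setoid_rewrite teval_TDist. setoid_rewrite teval_TNorm.
  setoid_rewrite map_teval_TConst. setoid_rewrite map_teval_TVars. cbn [teval].
  assert (Bw : forall t v w, length w = (m + n)%nat ->
    select (seq 2 (m + n)) ([t; v] ++ w) = w) by (intros; now apply select_block_end).
  assert (Bx : forall t v x w, length x = m -> select (seq 2 m) ([t; v] ++ x ++ w) = x)
    by (intros; now apply select_block).
  assert (By : forall t v x y, length x = m -> length y = n ->
    select (seq (2 + m) n) ([t; v] ++ x ++ y) = y).
  { intros t v x y Hx Hy. rewrite app_assoc. apply select_block_end; trivial. cbn. lia. }
  assert (Bz : forall t v w u, length w = (m + n)%nat -> length u = m ->
     select (seq (2 + (m + n)) m) (([t; v] ++ w) ++ u) = u).
  { intros t v w u Hw Hu. apply select_block_end; trivial. cbn. lia. }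
  assert (Bx' : forall t v x w u, length x = m ->
    select (seq 2 m) (([t; v] ++ x ++ w) ++ u) = x).
  { intros t v x w u Hx. rewrite <- !app_assoc. now apply Bx. }
  split.
  - intros [Hz H]. destruct z as [|t [|v [|]]]; try discriminate. exists t, v. split; trivial.
    destruct H as [H|[w [Hw [Hg [Ha [Hv Hn]]]]]]; [now left|right].
    rewrite Bw in Hg by trivial. destruct Hg as [x [Ox ->]].
    rewrite Bx in Ha by auto. rewrite By in Hv by auto. cbn in Hv.
    exists x. repeat split; trivial; [lra|].
    intros u Hu. apply Rnot_lt_le. intros Hlt. apply Hn.
    assert (Lu : length u = m) by apply Hu.
    exists u. rewrite Bz, Bx' by auto. split; auto.
  - intros [t [v [-> H]]]. split; trivial. destruct H as [H|[x [Ox [Ha [Hv Hn]]]]]; [now left|right].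
    assert (Lw : length (x ++ f x) = (m + n)%nat) by (rewrite length_app; auto).
    exists (x ++ f x). rewrite Bw, Bx, By by auto.
    split; trivial. split; [now exists x|]. split; [lra|]. split; [exact Hv|].
    intros [u [Lu [Hu Hd]]]. rewrite Bz in Hu, Hd by auto. rewrite Bx' in Hd by auto.
    apply Hn in Hu. cbn in Hd. lra.
Qed.

(** * Positivity of the comparison function and conclusion *)

(** Otherwise points near [a], at distance at least [t] from the zero set, have arbitrarily small
    [|f x|]. They cluster at some [c], and [(c, 0)] lies in the closure of the graph, so [c] is a
    generalized zero closer than [t] to some of them. *)
Lemma far_values_pos m n Omega f a :
  (forall x, Omega x -> length x = m) ->
  (forall x, Omega x -> length (f x) = n) ->
  length a = m -> forall t, 0 < t ->
  exists b, 0 < b /\ forall v, far_values m n Omega f a t v -> b <= v.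
Proof.
  intros hO hn La t Ht. apply NNPP. intros Hno.
  destruct (cluster_point a (fun e x => Omega x /\ edist x a <= 1 /\
     (forall z, gen_zero_set m n Omega f z -> t <= edist x z) /\ enorm (f x) < e))
    as [c [Lc Hc]].
  - intros e He. apply NNPP. intros Hn. apply Hno.
    exists (Rmin e 1). split; [apply Rmin_pos; lra|].
    intros v [->|[x [Ox [Hx [-> Hz]]]]]; [apply Rmin_r|].
    apply Rnot_lt_le. intros Hlt. apply Hn. exists x. repeat split; trivial.
    pose proof (Rmin_l e 1). lra.
  - intros e e' x Hee [H1 [H2 [H3 H4]]]. repeat split; trivial. lra.
  - intros e x [Ox [Hx _]]. apply edist_coord; trivial. rewrite La. auto.
  - pose proof (pos_INR m) as Hm. rewrite La in Lc.
    assert (Zc : gen_zero_set m n Omega f c).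
    { split; trivial. split; [now rewrite length_app, repeat_length, Lc|].
      intros eps Heps.
      (* The [m] coordinates of [x - c] contribute at most [m] such shares of [eps], and [|f x|]
         less than one more. *)
      assert (Heta : 0 < eps / (INR m + 1)) by (apply Rdiv_lt_0_compat; lra).
      destruct (Hc _ Heta) as [x [[Ox [_ [_ Hf]]] Hx]].
      exists (x ++ f x). split; [now exists x|].
      apply edist_le_sum in Hx. rewrite Lc in Hx.
      eapply Rle_lt_trans; [apply edist_app; rewrite Lc; symmetry; auto|].
      rewrite edist_origin, edist_sym by auto.
      replace eps with (INR m * (eps / (INR m + 1)) + eps / (INR m + 1)) by (field; lra). lra. }
    assert (Heta : 0 < t / (INR m + 1)) by (apply Rdiv_lt_0_compat; lra).
    destruct (Hc _ Heta) as [x [[_ [_ [Hz _]]] Hx]].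
    apply edist_le_sum in Hx. rewrite Lc in Hx. specialize (Hz c Zc).
    assert (INR m * (t / (INR m + 1)) = t - t / (INR m + 1)) by (field; lra). lra.
Qed.

(** A point of [Z] guarantees that the infimum exists, so [epsilon] returns it. *)
Lemma setdist_spec Z x a : Z a -> is_glb (fun r => exists z, Z z /\ r = edist x z) (setdist Z x).
Proof.
  intros Ha. unfold setdist. apply epsilon_spec. apply (glb_exists _ 0).
  - eauto.
  - intros y [z [_ ->]]. apply edist_nonneg.
Qed.

Theorem mainTheorem3 (S : OMinimalStructure) (p : nat) (hp : (1 <= p)%nat)
  (m n : nat) (Omega : list R -> Prop) (f : list R -> list R)
  (hOmega : forall x, Omega x -> length x = m)
  (hf_dim : forall x, Omega x -> length (f x) = n)
  (hf_def : Def S (m + n) (graph Omega f))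
  (a : list R) (ha : gen_zero_set m n Omega f a) :
  exists U : list R -> Prop,
    (exists r, 0 < r /\ forall x, length x = m -> edist x a < r -> U x) /\
    exists phi : R -> R,
      (forall t, phi (- t) = - phi t) /\
      (forall s t, s < t -> phi s < phi t) /\
      (forall y, exists t, phi t = y) /\
      definable_fun1 S phi /\
      of_class_C p phi /\
      p_flat_at_zero p phi /\
      forall x, U x -> Omega x ->
        enorm (f x) >= phi (setdist (gen_zero_set m n Omega f) x).
Proof.
  set (V := far_values m n Omega f a).
  assert (V1 : forall t, V t 1) by (intros t; now left).
  assert (V0 : forall t v, V t v -> 0 <= v).
  { intros t v [->|[x [_ [_ [-> _]]]]]; [lra|apply enorm_nonneg]. }
  assert (Hglb : forall t, is_glb (V t) (epsilon (inhabits 0) (is_glb (V t)))).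
  { intros t. apply epsilon_spec, (glb_exists _ 0); eauto. }
  set (mu := fun t => epsilon (inhabits 0) (is_glb (V t))) in *.
  change (forall t, is_glb (V t) (mu t)) in Hglb.
  destruct (flat_minorant S mu) with (p := p)
    as [phi [H1 [H2 [H3 [H4 [H5 [H6 H7]]]]]]].
  - apply (glb_definable S V); trivial. now apply far_values_definable.
  - intros t. destruct (Hglb t) as [L G]. split; [apply G; eauto|now apply L].
  - intros t Ht. destruct (far_values_pos m n Omega f a hOmega hf_dim (proj1 ha) t Ht) as [b [Hb H]].
    apply Rlt_le_trans with b; trivial. now apply Hglb.
  (* Moving the threshold from [t] down to [s] enlarges the set of values, hence lowers its
     infimum. *)
  - intros s t Hst. apply (Hglb t). intros v Hv. apply (Hglb s).
    destruct Hv as [->|[x [Ox [Hx [Hv Hz]]]]]; [apply V1|].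
    right. exists x. repeat split; trivial. intros z Hzz. specialize (Hz z Hzz). lra.
  (* Since [a] is a generalized zero, the distance [s] is below [/ 2], where [phi <= mu]. Moreover
     [x] lies within [1] of [a], so [|f x|] is among the values at threshold [s] and
     [mu s <= |f x|]. *)
  - exists (fun x => edist x a < / 2). split; [exists (/ 2); split; [lra|auto]|].
    exists phi. repeat (split; [assumption|]).
    intros x Ux Ox. apply Rle_ge.
    destruct (setdist_spec _ x a ha) as [L G].
    set (s := setdist (gen_zero_set m n Omega f) x) in *.
    assert (s <= edist x a) by (apply L; eauto).
    assert (0 <= s) by (apply G; intros y [z [_ ->]]; apply edist_nonneg).
    apply Rle_trans with (mu s); [apply H7; lra|].
    apply (Hglb s). right. exists x. repeat split; trivial; [lra|].
    intros z Hz. apply L. eauto.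
Qed.
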